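(* Fix $\gamma>0$. The Dirichlet form $(\mathcal{E},\mathcal{F})$ on $L^2(\mathbf{R}^3,m)$ defined in the context is recurrent, conservative, and irreducible. Consequently, the symmetry measure $m$ is an invariant distribution for the associated diffusion $X$.
   Context: Let $\psi_\gamma(x)=\frac{\sqrt{\gamma}}{\sqrt{2\pi}}\frac{e^{-\gamma|x|}}{|x|}$, $m(dx)=\psi_\gamma(x)^2dx$ on $\mathbf{R}^3$, $\mathcal{F}=\{u\in L^2(\mathbf{R}^3,m):\nabla u\in L^2(\mathbf{R}^3,m)\}$ (distributional gradient), and $\mathcal{E}(u,v)=\frac12\int_{\mathbf{R}^3}\nabla u\cdot\nabla v\,dm$ for $u,v\in\mathcal{F}$. This is a regular Dirichlet form on $L^2(\mathbf{R}^3,m)$ with core $C_c^\infty(\mathbf{R}^3)$; $X$ denotes the associated $m$-symmetric diffusion on $\mathbf{R}^3$ and $(P_t)_{t\ge0}$ its transition semigroup. Conservative means $P_t1=1$ $m$-a.e. for all $t>0$. An invariant distribution is a probability measure $m$ with $\int P_tf\,dm=\int f\,dm$ for all bounded measurable $f$ and all $t\geq 0$. *)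

(* Defs.v *)
From HB Require Import structures.
From mathcomp Require Import all_boot all_order all_algebra.
From mathcomp Require Import all_classical all_reals all_analysis.
From mathcomp Require Import measurable_realfun.
Set Implicit Arguments.
Unset Strict Implicit.
Unset Printing Implicit Defensive.
Import Order.TTheory GRing.Theory Num.Theory.
Import numFieldNormedType.Exports.
Local Open Scope classical_set_scope.
Local Open Scope ring_scope.

(* The factors are [measurableTypeR R], the copy of [R] on which the library
   puts [lebesgue_measure]; topology and linear structure are those of [R]. *)
Notation R3 R :=
  (measurableTypeR R * measurableTypeR R * measurableTypeR R)%type.

(* Elements of L^p(m) are handled through representatives [u : X -> R] with
   [u \in Lfun m p]; an operator is a map on representatives, constrained only
   on [Lfun m 2] and up to m-a.e. equality. Semigroups are constrained at
   positive times only. *)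
Section semigroups.
Context {d} {X : measurableType d} {R : realType}.
Variable m : {measure set X -> \bar R}.
Implicit Types (u v f g S : X -> R) (T : R -> (X -> R) -> (X -> R)).

Definition Lpnorm (p : \bar R) u : \bar R := ('N[m]_p[EFin \o u])%E.

Definition L2inner u v : R := \int[m]_x (u x * v x).

Record markovian_semigroup T : Prop := MarkovianSemigroup {
  msg_L2 : forall t u, 0 < t -> u \in Lfun m 2%:E -> T t u \in Lfun m 2%:E ;
  msg_ae : forall t u v, 0 < t -> u \in Lfun m 2%:E -> v \in Lfun m 2%:E ->
    u = v %[ae m] -> T t u = T t v %[ae m] ;
  msg_linear : forall t (a : R) u v, 0 < t ->
    u \in Lfun m 2%:E -> v \in Lfun m 2%:E ->
    T t (fun x => a * u x + v x) = (fun x => a * T t u x + T t v x) %[ae m] ;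
  msg_symmetric : forall t u v, 0 < t ->
    u \in Lfun m 2%:E -> v \in Lfun m 2%:E ->
    L2inner (T t u) v = L2inner u (T t v) ;
  msg_contraction : forall t u, 0 < t -> u \in Lfun m 2%:E ->
    (Lpnorm 2%:E (T t u) <= Lpnorm 2%:E u)%E ;
  msg_semigroup : forall s t u, 0 < s -> 0 < t -> u \in Lfun m 2%:E ->
    T (s + t) u = T s (T t u) %[ae m] ;
  msg_continuous : forall u, u \in Lfun m 2%:E ->
    Lpnorm 2%:E (T t u \- u) @[t --> 0^'+] --> 0%E ;
  msg_markovian : forall t u, 0 < t -> u \in Lfun m 2%:E ->
    {ae m, forall x, 0 <= u x <= 1} -> {ae m, forall x, 0 <= T t u x <= 1} }.

(* [u] belongs to the domain of the L^2 generator [A] of [T], and [A u = f]. *)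
Definition generator T u f : Prop :=
  Lpnorm 2%:E (fun x => t^-1 * (T t u x - u x) - f x) @[t --> 0^'+]
    --> 0%E.

(* The correspondence between a closed symmetric form [(E, F)] and its
   semigroup: the generator [A] of [T] is the operator of the form, that is
   [u \in D(A)] and [A u = f] iff [u \in F] and [E(u, v) = (- f, v)] for all
   [v \in F]. *)
Definition semigroup_of_form (F : set (X -> R)) (E : (X -> R) -> (X -> R) -> R)
    T : Prop :=
  markovian_semigroup T /\
  forall u f, u \in Lfun m 2%:E -> f \in Lfun m 2%:E ->
    generator T u f <-> F u /\ forall v, F v -> E u v = L2inner (\- f) v.

(* Meant for a finite measure [m], where the constant [1] is in L^2(m). *)
Definition conservative T : Prop :=
  forall t, 0 < t -> T t (cst 1) = cst 1 %[ae m].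

Definition invariant_set T (B : set X) : Prop :=
  measurable B /\
  forall t f, 0 < t -> f \in Lfun m 2%:E ->
    T t (\1_B \* f) = \1_B \* T t f %[ae m].

Definition irreducible T : Prop :=
  forall B, invariant_set T B -> m B = 0%E \/ m (~` B) = 0%E.

(* The extension of the operator [P] by continuity from L^1 /\ L^2 to L^1
   sends [f] to [g]. *)
Definition L1_extension (P : (X -> R) -> (X -> R)) f g : Prop :=
  [/\ f \in Lfun m 1%:E, g \in Lfun m 1%:E &
    exists f_ : nat -> X -> R,
      [/\ forall n, f_ n \in Lfun m 1%:E, forall n, f_ n \in Lfun m 2%:E,
          Lpnorm 1%:E (f_ n \- f) @[n --> \oo] --> 0%E &
          Lpnorm 1%:E (P (f_ n) \- g) @[n --> \oo] --> 0%E]].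

(* [S] is the L^1-valued integral of [T s f] over [0 < s <= t], identified by
   its integrals over measurable sets. *)
Definition time_integral T f (t : R) S : Prop :=
  exists2 Tf : R -> X -> R,
    (forall s, 0 < s -> L1_extension (T s) f (Tf s)) &
    S \in Lfun m 1%:E /\
    forall A, measurable A ->
      \int[m]_(x in A) S x =
      \int[lebesgue_measure]_(s in `]0, t]) \int[m]_(x in A) Tf s x.

(* [h] is a version of the potential [G f = lim_N \int_0^N T_s f ds]. *)
Definition potential T f (h : X -> \bar R) : Prop :=
  measurable_fun setT h /\
  exists2 S : nat -> X -> R,
    (forall N, time_integral T f N%:R (S N)) &
    {ae m, forall x, (S N x)%:E @[N --> \oo] --> h x}.

Definition recurrent T : Prop :=
  forall f (h : X -> \bar R), f \in Lfun m 1%:E ->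
    {ae m, forall x, 0 <= f x} -> potential T f h ->
    {ae m, forall x, h x = 0%E \/ h x = +oo%E}.

Definition bounded_measurable f : Prop :=
  measurable_fun setT f /\ exists M, forall x, `|f x| <= M.

Definition invariant_distribution (P : R -> (X -> R) -> (X -> R)) : Prop :=
  m setT = 1%E /\
  forall t f, 0 <= t -> bounded_measurable f ->
    \int[m]_x P t f x = \int[m]_x f x.

End semigroups.

(* A process killed at its lifetime [zeta]: the value [X t w] is meaningful only
   when [t < zeta w], after which the path sits in the cemetery. *)
Section diffusions.
Context {R : realType} {d : measure_display} {W : measurableType d}.
Variables (P : R3 R -> probability W R) (X : R -> W -> R3 R)
  (zeta : W -> \bar R).

Definition in_at (t : R) (B : set (R3 R)) : set W :=
  [set w | (t%:E < zeta w)%E /\ B (X t w)].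

(* [f] is implicitly extended by [0] at the cemetery. *)
Definition transition (t : R) (f : R3 R -> R) (x : R3 R) : R :=
  \int[P x]_(w in [set w | (t%:E < zeta w)%E]) f (X t w).

Definition filtration (Fil : R -> set (set W)) : Prop :=
  [/\ forall t, 0 <= t -> sigma_algebra setT (Fil t),
      forall t, 0 <= t -> Fil t `<=` measurable,
      forall s t, 0 <= s -> s <= t -> Fil s `<=` Fil t &
      forall t, 0 <= t -> \bigcap_(s in [set s | t < s]) Fil s `<=` Fil t].

Definition stopping_time (Fil : R -> set (set W)) (sigma : W -> \bar R) :=
  (forall w, (0 <= sigma w)%E) /\
  forall t, 0 <= t -> Fil t [set w | (sigma w <= t%:E)%E].

(* [L] is in the sigma-algebra of events prior to [sigma]. *)
Definition prior_event (Fil : R -> set (set W)) (sigma : W -> \bar R)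
    (L : set W) : Prop :=
  measurable L /\
  forall t, 0 <= t -> Fil t (L `&` [set w | (sigma w <= t%:E)%E]).

Definition strong_markov (Fil : R -> set (set W)) : Prop :=
  forall (x : R3 R) (sigma : W -> \bar R) (L : set W) (s : R) (B : set (R3 R)),
    stopping_time Fil sigma -> prior_event Fil sigma L -> 0 <= s ->
    measurable B ->
    P x (L `&` [set w | (sigma w < +oo)%E /\ in_at (fine (sigma w) + s) B w]) =
    (\int[P x]_(w in L `&` [set w | (sigma w < zeta w)%E])
       P (X (fine (sigma w)) w) (in_at s B))%E.

Definition diffusion : Prop :=
  exists Fil : R -> set (set W),
  [/\ filtration Fil,
      (forall t B, 0 <= t -> measurable B -> Fil t (in_at t B)),
      (forall t B, 0 <= t -> measurable B ->
        measurable_fun setT (fun x => P x (in_at t B))),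
      (forall x, P x (in_at 0 [set x]) = 1%E) &
      (forall w, {within [set t | 0 <= t /\ (t%:E < zeta w)%E],
        continuous (X ^~ w)}) /\
      strong_markov Fil].

(* The transition semigroup of the process, which acts on functions, is a
   version of the L^2 semigroup [T], which acts on classes. *)
Definition associated (m : {measure set (R3 R) -> \bar R})
    (T : R -> (R3 R -> R) -> (R3 R -> R)) : Prop :=
  forall t f, 0 < t -> bounded_measurable f -> f \in Lfun m 2%:E ->
    transition t f = T t f %[ae m].

End diffusions.

Section weighted_form.
Context {R : realType}.

Definition leb3 : set (R3 R) -> \bar R :=
  ((@lebesgue_measure R \x @lebesgue_measure R) \x @lebesgue_measure R)%E.
HB.instance Definition _ := Measure.on leb3.

Definition enorm (x : R3 R) : R :=
  Num.sqrt (x.1.1 ^+ 2 + x.1.2 ^+ 2 + x.2 ^+ 2).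

(* Division by zero makes [psi gamma] vanish at the origin, a null set. *)
Definition psi (gamma : R) (x : R3 R) : R :=
  Num.sqrt gamma / Num.sqrt (2 * pi) * (expR (- gamma * enorm x) / enorm x).

Lemma measurable_enorm : measurable_fun setT enorm.
Proof.
have msqrt : measurable_fun setT (@Num.sqrt R).
  by apply: continuous_measurable_fun; exact: sqrt_continuous.
apply: (measurableT_comp msqrt).
have m2 : measurable_fun setT (fun x : R3 R => x.2 : R) by exact: measurable_snd.
have m11 : measurable_fun setT (fun x : R3 R => x.1.1 : R).
  exact: measurableT_comp measurable_fst measurable_fst.
have m12 : measurable_fun setT (fun x : R3 R => x.1.2 : R).
  exact: measurableT_comp measurable_snd measurable_fst.
by apply: measurable_funD; [apply: measurable_funD|]; exact: measurable_funX.
Qed.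

Lemma measurable_psi gamma : measurable_fun setT (psi gamma).
Proof.
apply: measurable_funM => //; apply: measurable_funM.
  apply: measurableT_comp; first exact: measurable_expR.
  by apply: measurable_funM => //; exact: measurable_enorm.
rewrite [X in measurable_fun _ X](_ : _ = (fun x => enorm x `^ (-1))).
  exact: measurableT_comp (measurable_powR _) measurable_enorm.
by apply/funext => x; rewrite powR_inv1// sqrtr_ge0.
Qed.

Definition psi_measure (gamma : R) (A : set (R3 R)) : \bar R :=
  (\int[leb3]_(x in A) (psi gamma x ^+ 2)%:E)%E.

Section psi_measure_is_measure.
Variable gamma : R.

Let psi_measure0 : psi_measure gamma set0 = 0%E.
Proof. by rewrite /psi_measure integral_set0. Qed.

Let psi_measure_ge0 A : (0 <= psi_measure gamma A)%E.
Proof. by apply: integral_ge0 => x _; rewrite lee_fin sqr_ge0. Qed.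

Let psi_measure_sigma_additive : semi_sigma_additive (psi_measure gamma).
Proof.
move=> /= A mA tA mUA; rewrite /psi_measure ge0_integral_bigcup//=.
- by apply: is_cvg_ereal_nneg_natsum_cond => n _ _; exact: psi_measure_ge0.
- apply/measurable_EFinP; apply: measurable_funTS.
  exact: measurable_funX (measurable_psi gamma).
- by move=> x _; rewrite lee_fin sqr_ge0.
Qed.

HB.instance Definition _ := isMeasure.Build _ _ _ (psi_measure gamma)
  psi_measure0 psi_measure_ge0 psi_measure_sigma_additive.

End psi_measure_is_measure.

Definition e3 (i : 'I_3) : R3 R :=
  ((i == 0 :> nat)%:R, (i == 1 :> nat)%:R, (i == 2 :> nat)%:R).

Definition partial (i : 'I_3) (f : R3 R -> R) : R3 R -> R :=
  fun x => 'D_(e3 i) f x.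

Fixpoint Cn (n : nat) (f : R3 R -> R) : Prop :=
  if n is n'.+1 then
    (forall i x, derivable f x (e3 i)) /\ forall i, Cn n' (partial i f)
  else continuous f.

(* C_c^oo *)
Definition test_function (f : R3 R -> R) : Prop :=
  (forall n, Cn n f) /\ compact (closure [set x | f x != 0]).

Definition locally_integrable3 (f : R3 R -> R) : Prop :=
  forall K, compact K -> leb3.-integrable K (EFin \o f).

(* [g] is the distributional gradient of [u]. *)
Definition distributional_gradient (u : R3 R -> R) (g : 'I_3 -> R3 R -> R) :=
  locally_integrable3 u /\
  forall i, locally_integrable3 (g i) /\
    forall phi, test_function phi ->
      \int[leb3]_x (u x * partial i phi x) = - \int[leb3]_x (g i x * phi x).

(* Locally integrable distributional gradients are unique up to null sets. *)
Definition grad (u : R3 R -> R) : 'I_3 -> R3 R -> R :=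
  xget (fun=> cst 0) [set g | distributional_gradient u g].

Definition form_domain (gamma : R) : set (R3 R -> R) :=
  [set u | u \in Lfun (psi_measure gamma) 2%:E /\
    exists2 g, distributional_gradient u g &
      forall i, g i \in Lfun (psi_measure gamma) 2%:E].

Definition energy (gamma : R) (u v : R3 R -> R) : R :=
  2^-1 * \int[psi_measure gamma]_x (\sum_(i < 3) grad u i x * grad v i x).

End weighted_form.

(* Main.v *)
Require Import Defs.
From HB Require Import structures.
From mathcomp Require Import all_boot all_order all_algebra.
From mathcomp Require Import all_classical all_reals all_analysis.
From mathcomp Require Import measurable_realfun.
From mathcomp Require Import ring lra.

(** Everything is read off the constant functions.

    The measure has mass one: in the variables x = z s, y = z t of the plane
    at height z, one has |x|^2 = z^2 (1 + s^2 + t^2), so that by Tonelli the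
    integral of psi^2 reduces to those of exp (- c |z|) over the line and of
    (1 + s^2 + t^2)^(-3/2) over the plane ([psi_measure_setT]). Constants are
    therefore in L^2; their gradient vanishes, so they lie in the form domain
    and E (1, v) = 0 for all v. The generator kills 1, and a vector killed by
    the generator of a contraction semigroup is fixed by the semigroup, whence
    T_t 1 = 1 ([form_conservative]).

    Conversely let T_t w = w for all t. The generator kills w, so that
    E (w, w) = 0 and the gradient of w vanishes almost everywhere, for the
    Lebesgue measure too since psi > 0 off the origin. A locally integrable
    function with null distributional gradient is constant
    ([null_gradient_ae_cst]), so the vectors fixed by the semigroup are the
    constants ([form_fixed_cst]).

    From here on only the Hilbert space geometry matters. The indicator of an
    invariant set is fixed, hence constant: this is irreducibility
    ([fixed_cst_irreducible]). By symmetry (T_s w, T_r w) depends on s + r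
    only, and ||T_s w|| decreases, so T_s w is Cauchy as s grows; its limit is
    fixed, hence is the mean of w ([T_ergodic]). Recurrence follows by duality
    ([ergodic_recurrent]): the integral of T_s f over a set A is that of
    f T_s 1_A, which stays above a positive constant for large s when A is not
    null and the integral of f is positive; so the potential of f has infinite
    integral over every non-null set, which excludes that it be at most k on
    such a set.

    For the process, the integral of T_t f is (T_t f, 1) = (f, T_t 1), the
    integral of f ([transition_invariant]); at time 0 the process is at its
    starting point.

    The two facts used about weak gradients, that they are unique and that a
    null gradient forces constancy, rest on tensor products
    F_0 (x) F_1 (y) F_2 (z) of test functions of one variable. Bump functions
    converge boundedly to the indicator of an interval, so a function which
    integrates to zero against all tensor products has zero integral over all
    boxes, hence over all measurable sets ([fundamental_lemma]). And a test
    function of mean zero on the line is the derivative of a test function, so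
    against a function with null gradient the integral of a tensor product
    depends on the F_j through their integrals only. *)

Set Implicit Arguments.
Unset Strict Implicit.
Unset Printing Implicit Defensive.

Import Order.TTheory GRing.Theory Num.Theory.
Import numFieldNormedType.Exports.

Local Open Scope classical_set_scope.
Local Open Scope ring_scope.

(** * Square-integrable functions on a probability space *)

Section real_integral.
Context {d} {X : measurableType d} {R : realType}.
Variable m : {measure set X -> \bar R}.
Implicit Types (u v f g : X -> R).

Lemma indic01 (A : set X) x : 0 <= (\1_A x : R) <= 1.
Proof. by rewrite indicE; case: (_ \in _); rewrite /= ?lexx ?ler01. Qed.

Definition clamp (t : R) : R := Num.max 0 (Num.min 1 t).

Lemma clamp01 t : 0 <= clamp t <= 1.
Proof. by rewrite /clamp le_max lexx/= ge_max ler01/= ge_min lexx. Qed.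

Lemma clamp_id t : 0 <= t <= 1 -> clamp t = t.
Proof. by move=> /andP[t0 t1]; rewrite /clamp (min_idPr t1) (max_idPr t0). Qed.

Lemma measurable_clamp : measurable_fun setT clamp.
Proof. by apply: measurable_maxr => //; exact: measurable_minr. Qed.

Lemma ae_eq_Rintegral f g : measurable_fun setT f -> measurable_fun setT g ->
  f = g %[ae m] -> \int[m]_x f x = \int[m]_x g x.
Proof.
move=> mf mg fg; congr fine; apply: ae_eq_integral => //.
- exact/measurable_EFinP.
- exact/measurable_EFinP.
- by apply: filterS fg => x h Dx; rewrite /= h.
Qed.

Lemma ge0_Rintegral_eq0 f : (forall x, 0 <= f x) ->
  m.-integrable setT (EFin \o f) -> \int[m]_x f x = 0 ->
  f = cst 0 %[ae m].
Proof.
move=> f0 fi int0.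
have mf := measurable_int _ fi.
have : (\int[m]_x `|(EFin \o f) x| = 0)%E.
  under eq_integral do rewrite gee0_abs ?lee_fin//.
  by rewrite -(fineK (integrable_fin_num measurableT fi)); congr (_%:E).
move/(ae_eq_integral_abs _ measurableT mf).
by apply: filterS => x + _ => /(_ I) [].
Qed.

Lemma integrable_bounded f : (m setT < +oo)%E -> measurable_fun setT f ->
  (exists M, forall x, `|f x| <= M) -> m.-integrable setT (EFin \o f).
Proof.
move=> fin mf [M fM]; apply: measurable_bounded_integrable => //.
exists M; split; first exact: num_real.
by move=> x Mx y _ /=; rewrite (le_trans (fM y))// ltW.
Qed.

End real_integral.

Section L2.
Context {d} {X : measurableType d} {R : realType}.
Variable m : {measure set X -> \bar R}.
Hypothesis m1 : m setT = 1%E.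
Implicit Types (u v w f g : X -> R).

Local Notation L2 u := (u \in Lfun m 2%:E).
Local Notation ip := (L2inner m).

Let mfin : (m setT < +oo)%E. Proof. by rewrite m1 ltry. Qed.

Lemma L2_measurable u : L2 u -> measurable_fun setT u.
Proof. by rewrite inE => /andP[/[!inE]]. Qed.

(** Turns the membership in [Lfun], stated with power functions and extended
    reals, into the two properties that are used in computations. *)
Lemma L2P u : L2 u <-> measurable_fun setT u /\
  m.-integrable setT (EFin \o (fun x => u x ^+ 2)).
Proof.
split=> [lu|[mu iu]].
  by split; [exact: L2_measurable|exact: Lfun2_integrable_sqr].
rewrite inE; apply/andP; split; rewrite inE//= /finite_norm unlock.
apply: poweR_lty.
have /integrableP[_] := iu; apply: le_lt_trans.
rewrite le_eqVlt; apply/orP; left; apply/eqP; apply: eq_integral => x _ /=.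
by rewrite powR_mulrn// normrX.
Qed.

Lemma Lpnorm2E u : L2 u -> Lpnorm m 2%:E u = (Num.sqrt (ip u u))%:E.
Proof.
move=> /L2P[mu iu]; rewrite /Lpnorm unlock /=.
have -> : (\int[m]_x (`|u x| `^ 2)%:E = (ip u u)%:E)%E.
  rewrite /L2inner /Rintegral fineK; last first.
    by apply: integrable_fin_num => //; under eq_fun do rewrite -expr2.
  by apply: eq_integral => x _; rewrite powR_mulrn// real_normK ?num_real// expr2.
by rewrite poweR_EFin powR12_sqrt//; apply: Rintegral_ge0 => x _; rewrite -expr2 sqr_ge0.
Qed.

Lemma L2D u v : L2 u -> L2 v -> L2 (fun x => u x + v x).
Proof. by move=> lu lv; exact: (Lfun_addr_closed m (lee1n 2)).2. Qed.

Lemma L2Z a u : L2 u -> L2 (fun x => a * u x).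
Proof.
move=> lu; rewrite (_ : (fun x => _) = a \o* u).
  by apply: Lfun_scale => //; rewrite ler1n.
by apply/funext => x /=; rewrite mulrC.
Qed.

Lemma L2B u v : L2 u -> L2 v -> L2 (fun x => u x - v x).
Proof.
move=> lu lv; rewrite (_ : (fun x => _) = (fun x => u x + (-1) * v x)).
  exact: L2D lu (L2Z _ lv).
by apply/funext => x; rewrite mulN1r.
Qed.

Lemma L2_bounded u : measurable_fun setT u -> (exists M, forall x, `|u x| <= M) ->
  L2 u.
Proof.
move=> mu [M uM]; apply/L2P; split => //.
apply: integrable_bounded => //; first exact: measurable_funX.
exists (M ^+ 2) => x.
by rewrite normrX ler_sqr ?nnegrE// (le_trans _ (uM x)).
Qed.

Lemma L2_01 u : measurable_fun setT u -> (forall x, 0 <= u x <= 1) -> L2 u.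
Proof.
move=> mu u01; apply: (L2_bounded mu); exists 1 => x.
by have /andP[u0 ?] := u01 x; rewrite ger0_norm.
Qed.

Lemma L2_cst c : L2 (cst c).
Proof. by apply: L2_bounded => //; exists `|c|. Qed.

Lemma L2_indic (A : set X) : measurable A -> L2 \1_A.
Proof.
by move=> mA; apply: L2_01; [exact: measurable_indic|move=> x; exact: indic01].
Qed.

Lemma L2_ip u v : L2 u -> L2 v -> m.-integrable setT (EFin \o (fun x => u x * v x)).
Proof. by move=> lu lv; apply/Lfun1_integrable; exact: Lfun2_mul_Lfun1. Qed.

Lemma L2_integrable u : L2 u -> m.-integrable setT (EFin \o u).
Proof.
move=> lu; have := L2_ip lu (L2_cst 1).
by congr (_.-integrable _ _); apply/funext => x /=; rewrite mulr1.
Qed.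

Lemma ipC u v : ip u v = ip v u.
Proof. by apply: eq_Rintegral => x _; rewrite mulrC. Qed.

Lemma ipDl u v w : L2 u -> L2 v -> L2 w ->
  ip (fun x => u x + v x) w = ip u w + ip v w.
Proof.
move=> lu lv lw; rewrite /L2inner.
under eq_Rintegral do rewrite mulrDl.
by rewrite RintegralD//; exact: L2_ip.
Qed.

Lemma ipZl a u w : L2 u -> L2 w -> ip (fun x => a * u x) w = a * ip u w.
Proof.
move=> lu lw; rewrite /L2inner.
under eq_Rintegral do rewrite -mulrA.
by rewrite RintegralZl//; exact: L2_ip.
Qed.

Lemma ipBl u v w : L2 u -> L2 v -> L2 w ->
  ip (fun x => u x - v x) w = ip u w - ip v w.
Proof.
move=> lu lv lw; rewrite /L2inner.
under eq_Rintegral do rewrite mulrBl.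
by rewrite RintegralB//; exact: L2_ip.
Qed.

Lemma ipZr a u w : L2 u -> L2 w -> ip w (fun x => a * u x) = a * ip w u.
Proof. by move=> lu lw; rewrite ipC ipZl// ipC. Qed.

Lemma ipDr u v w : L2 u -> L2 v -> L2 w ->
  ip w (fun x => u x + v x) = ip w u + ip w v.
Proof. by move=> lu lv lw; rewrite ipC ipDl// !(ipC w). Qed.

Lemma ipBr u v w : L2 u -> L2 v -> L2 w ->
  ip w (fun x => u x - v x) = ip w u - ip w v.
Proof. by move=> lu lv lw; rewrite ipC ipBl// !(ipC w). Qed.

Lemma ip_ge0 u : 0 <= ip u u.
Proof. by apply: Rintegral_ge0 => x _; rewrite -expr2 sqr_ge0. Qed.

Lemma ip_ae u u' v v' : L2 u -> L2 u' -> L2 v -> L2 v' ->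
  u = u' %[ae m] -> v = v' %[ae m] -> ip u v = ip u' v'.
Proof.
move=> lu lu' lv lv' uu' vv'; apply: ae_eq_Rintegral.
- by apply: measurable_funM; exact: L2_measurable.
- by apply: measurable_funM; exact: L2_measurable.
- by apply: filterS2 uu' vv' => x e1 e2 Dx; rewrite e1// e2.
Qed.

Lemma ip_eq0 u : L2 u -> ip u u = 0 -> u = cst 0 %[ae m].
Proof.
move=> lu u0.
have /ge0_Rintegral_eq0 : forall x, 0 <= u x * u x by move=> x; rewrite -expr2 sqr_ge0.
move=> /(_ _ (L2_ip lu lu) u0); apply: filterS => x + _ => /(_ I)/eqP.
by rewrite mulf_eq0 orbb => /eqP.
Qed.

Lemma ip_sqrB u v : L2 u -> L2 v ->
  ip (fun x => u x - v x) (fun x => u x - v x) = ip u u + ip v v - 2 * ip u v.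
Proof.
move=> lu lv; have luv := L2B lu lv; rewrite ipBl// !ipBr// [ip v u]ipC; ring.
Qed.

(** The norm of the vector (v, v) u - (u, v) v is nonnegative; when (v, v) = 0,
    v is null and both sides vanish. *)
Lemma cauchy_schwarz u v : L2 u -> L2 v ->
  ip u v ^+ 2 <= ip u u * ip v v.
Proof.
move=> lu lv.
set w := (fun x => ip v v * u x - ip u v * v x).
have lw : L2 w by apply: L2B; exact: L2Z.
have := ip_ge0 w.
have lz1 := L2Z (ip v v) lu; have lz2 := L2Z (ip u v) lv.
rewrite /w ip_sqrB// !(ipZl, ipZr)//.
have := ip_ge0 v; rewrite le_eqVlt => /predU1P[v0 _|v0].
  have := ip_eq0 lv (esym v0) => vae.
  have -> : ip u v = ip u (cst 0).
    by apply: (ip_ae lu lu lv (L2_cst 0) _ vae); exact: ae_eq_refl.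
  rewrite -v0 mulr0 ipC /L2inner; under eq_Rintegral do rewrite mul0r.
  by rewrite Rintegral_cst// mul0r expr0n.
move=> h; have {}h : 0 <= ip v v * (ip u u * ip v v - ip u v ^+ 2).
  by apply: le_trans h _; rewrite le_eqVlt; apply/orP; left; apply/eqP; ring.
by rewrite pmulr_rge0// in h; rewrite -subr_ge0.
Qed.

(** The norm of L^2 as a real number, which [Lpnorm] is by [Lpnorm2E]. *)
Definition nrm u : R := Num.sqrt (ip u u).

Lemma nrm_ge0 u : 0 <= nrm u. Proof. exact: sqrtr_ge0. Qed.

Lemma nrm_sqr u : nrm u ^+ 2 = ip u u.
Proof. by rewrite sqr_sqrtr// ip_ge0. Qed.

Lemma ip_le_nrm u v : L2 u -> L2 v -> `|ip u v| <= nrm u * nrm v.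
Proof.
move=> lu lv; rewrite -[leRHS]ger0_norm ?mulr_ge0 ?nrm_ge0//.
by rewrite -ler_sqr ?nnegrE// !real_normK ?num_real// exprMn !nrm_sqr cauchy_schwarz.
Qed.

Lemma nrmD u v : L2 u -> L2 v -> nrm (fun x => u x + v x) <= nrm u + nrm v.
Proof.
move=> lu lv; rewrite -ler_sqr ?nnegrE ?addr_ge0 ?nrm_ge0// nrm_sqr.
have luv := L2D lu lv.
rewrite ipDl// !ipDr// [ip v u]ipC.
have := ip_le_nrm lu lv; have := ler_norm (ip u v).
rewrite sqrrD !nrm_sqr; lra.
Qed.

Lemma nrm_ae u v : L2 u -> L2 v -> u = v %[ae m] -> nrm u = nrm v.
Proof. by move=> lu lv uv; rewrite /nrm (ip_ae lu lv lu lv uv uv). Qed.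

Lemma nrm_eq0 u : L2 u -> nrm u = 0 -> u = cst 0 %[ae m].
Proof. by move=> lu u0; apply: ip_eq0 => //; rewrite -nrm_sqr u0 expr0n. Qed.

Lemma nrmZ a u : L2 u -> nrm (fun x => a * u x) = `|a| * nrm u.
Proof.
move=> lu; have lau := L2Z a lu.
rewrite /nrm ipZl// ipC ipZl// mulrA -expr2 sqrtrM ?sqr_ge0// sqrtr_sqr//.
Qed.

Lemma ip_cst1 u : ip u (cst 1) = \int[m]_x u x.
Proof. by apply: eq_Rintegral => x _; rewrite mulr1. Qed.

Lemma nrm1 : nrm (cst 1) = 1.
Proof. by rewrite /nrm ip_cst1 Rintegral_cst// m1 mulr1 sqrtr1. Qed.

End L2.

(** * Symmetric contraction semigroups and their generator *)

Section semigroup.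
Context {d} {X : measurableType d} {R : realType}.
Variable m : {measure set X -> \bar R}.
Hypothesis m1 : m setT = 1%E.
Variable T : R -> (X -> R) -> (X -> R).
Hypothesis msgT : markovian_semigroup m T.
Implicit Types (u v w f g : X -> R).

Local Notation L2 u := (u \in Lfun m 2%:E).
Local Notation nrm := (nrm m).

Let TL2 t u : 0 < t -> L2 u -> L2 (T t u). Proof. exact: (msg_L2 msgT). Qed.

Lemma nrm_T t u : 0 < t -> L2 u -> nrm (T t u) <= nrm u.
Proof.
move=> t0 lu; have := msg_contraction msgT t0 lu.
by rewrite !Lpnorm2E ?lee_fin//; exact: TL2.
Qed.

Lemma T_sub t u v : 0 < t -> L2 u -> L2 v ->
  T t (fun x => u x - v x) = (fun x => T t u x - T t v x) %[ae m].
Proof.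
move=> t0 lu lv.
have := msg_linear msgT (-1) t0 lv lu.
rewrite (_ : (fun x => -1 * v x + u x) = (fun x => u x - v x)); last first.
  by apply/funext => x; rewrite mulN1r addrC.
by apply: filterS => x + _ => /(_ I) ->; rewrite mulN1r addrC.
Qed.

Lemma T_semigroup s t u : 0 < s -> 0 < t -> L2 u ->
  T s (T t u) = T (s + t) u %[ae m].
Proof. by move=> s0 t0 lu; apply: ae_eq_sym; exact: (msg_semigroup msgT). Qed.

Lemma nrm_TB t u v : 0 < t -> L2 u -> L2 v ->
  nrm (fun x => T t u x - T t v x) <= nrm (fun x => u x - v x).
Proof.
move=> t0 lu lv; rewrite -(nrm_ae _ _ (T_sub t0 lu lv)); first last.
- by apply: L2B; exact: TL2.
- by apply: TL2 => //; exact: L2B.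
- by apply: nrm_T => //; exact: L2B.
Qed.

Lemma fixed_generator w : L2 w -> (forall t, 0 < t -> T t w = w %[ae m]) ->
  generator m T w (cst 0).
Proof.
move=> lw fw; apply: cvg_near_cst; near=> t.
have t0 : 0 < t by [].
have lq : L2 (fun x => t^-1 * (T t w x - w x) - cst 0 x).
  by apply: L2B (L2_cst m1 0); apply: L2Z; apply: L2B => //; exact: TL2.
rewrite Lpnorm2E// -/(nrm _) (@nrm_ae _ _ _ m _ (cst 0)) ?L2_cst//.
  rewrite /nrm /L2inner; under eq_Rintegral do rewrite mulr0.
  by rewrite Rintegral_cst// mul0r sqrtr0.
by apply: filterS (fw t t0) => x + _ => /(_ I) ->; rewrite subrr mulr0 subr0.
Unshelve. all: by end_near. Qed.

(** With D s = ||T_s w - w||, the semigroup property and the contraction give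
    D (2 s) <= 2 D s, so D t <= 2^n D (t / 2^n) for all n, and the right-hand
    side tends to 0 because D s = o(s) when the generator kills w. *)
Lemma generator_fixed w t : L2 w -> generator m T w (cst 0) -> 0 < t ->
  T t w = w %[ae m].
Proof.
move=> lw gw t0.
pose D s := nrm (fun x => T s w x - w x).
have lD s : 0 < s -> L2 (fun x => T s w x - w x).
  by move=> s0; apply: L2B => //; exact: TL2.
have D2 s : 0 < s -> D (s + s) <= 2 * D s.
  move=> s0; have lss : L2 (T s (T s w)) by do 2 apply: TL2 => //.
  have lsw := TL2 s0 lw.
  rewrite /D (@nrm_ae _ _ _ m _
    (fun x => (T s (T s w) x - T s w x) + (T s w x - w x))); last 3 first.
  - by apply: lD; exact: addr_gt0.
  - by apply: L2D; [exact: L2B|exact: lD].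
  - have := T_semigroup s0 s0 lw; apply: filterS => x + _ => /(_ I) <-.
    by rewrite addrA subrK.
  rewrite (le_trans (nrmD m1 _ (lD _ s0)))//; first exact: L2B.
  by rewrite mulr2n mulrDl !mul1r lerD2r nrm_TB.
have Dn n : D t <= 2 ^+ n * D (t / 2 ^+ n).
  elim: n => [|n IH]; first by rewrite expr0 mul1r divr1.
  apply: le_trans IH _; rewrite exprSr -mulrA ler_wpM2l ?exprn_ge0//.
  rewrite [in leLHS](_ : t / 2 ^+ n = t / (2 ^+ n * 2) + t / (2 ^+ n * 2)).
    by apply: D2; rewrite divr_gt0// mulr_gt0// exprn_gt0.
  by field; rewrite expf_neq0.
suff : D t <= 0.
  move=> Dt; have {}Dt : D t = 0 by apply/le_anti; rewrite Dt nrm_ge0.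
  have := nrm_eq0 (lD _ t0) Dt.
  by apply: filterS => x + _ => /(_ I)/eqP; rewrite subr_eq0 => /eqP.
apply/ler_addgt0Pl => e e0; rewrite addr0.
have /fine_cvgP[_ /cvgrPdist_le/(_ (e / t))] := gw.
rewrite divr_gt0// => /(_ isT)[r /= r0 hr].
(* r is a radius below which the difference quotient is at most e / t *)
have [n tn] : exists n, t / 2 ^+ n < r.
  have : (t * 2^-1 ^+ n) @[n --> \oo] --> (t * 0).
    by apply: cvgMr; apply: cvg_expr; rewrite ger0_norm// invf_lt1 ?ltr1n.
  rewrite mulr0 => /cvgrPdist_lt/(_ _ r0)[n _ hn]; exists n.
  have := hn n (leqnn n); rewrite /= sub0r normrN exprVn => /(le_lt_trans _); apply.
  exact: ler_norm.
have tn0 : 0 < t / 2 ^+ n by rewrite divr_gt0// exprn_gt0.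
have := hr (t / 2 ^+ n); rewrite /= sub0r normrN gtr0_norm// => /(_ tn tn0).
have lq : L2 (fun x => (t / 2 ^+ n)^-1 * (T (t / 2 ^+ n) w x - w x)).
  by apply: L2Z; exact: lD.
rewrite (_ : (fun x => _ - cst 0 x) =
    fun x => (t / 2 ^+ n)^-1 * (T (t / 2 ^+ n) w x - w x)); last first.
  by apply/funext => x; rewrite subr0.
rewrite Lpnorm2E//= sub0r normrN -/(nrm _) nrmZ ?lD//.
rewrite ger0_norm ?mulr_ge0 ?nrm_ge0// gtr0_norm ?invr_gt0// => h.
apply: le_trans (Dn n) _; rewrite -/(D _) ler_pdivlMr// in h.
apply: le_trans h; rewrite le_eqVlt; apply/orP; left; apply/eqP.
by field; rewrite expf_neq0 ?lt0r_neq0.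
Qed.

End semigroup.

(** * Rapidly Cauchy sequences of square-integrable functions *)

Section L2_limit.
Context {d} {X : measurableType d} {R : realType}.
Variable m : {measure set X -> \bar R}.
Hypothesis m1 : m setT = 1%E.
Implicit Types (u w : X -> R).

Local Notation L2 u := (u \in Lfun m 2%:E).
Local Notation nrm := (nrm m).

Lemma L2_normr u : L2 u -> L2 (fun x => `|u x|).
Proof.
move=> /L2P[mu iu]; apply/L2P; split; first exact: measurableT_comp.
rewrite (_ : EFin \o _ = EFin \o (fun x => u x ^+ 2))//.
by apply/funext => x /=; rewrite real_normK// num_real.
Qed.

Lemma integral_normr_le_nrm u : L2 u -> (\int[m]_x `|u x|%:E <= (nrm u)%:E)%E.
Proof.
move=> lu; have lau := L2_normr lu.
rewrite -(fineK (integrable_fin_num measurableT (L2_integrable m1 lau))) lee_fin.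
have := ip_le_nrm m1 lau (L2_cst m1 1); rewrite (nrm1 m1) mulr1 ip_cst1.
rewrite ger0_norm; last exact: Rintegral_ge0.
move=> /le_trans; apply; rewrite le_eqVlt; apply/orP; left; apply/eqP.
rewrite /nrm; congr Num.sqrt; apply: eq_Rintegral => x _.
by rewrite -!expr2 real_normK// num_real.
Qed.

(** The series of the increments |u_{k+1} - u_k| has a finite integral, hence is
    finite almost everywhere, and where it is the sequence converges. *)
Lemma fast_cauchy_ae_cvg (u_ : nat -> X -> R) : (forall k, L2 (u_ k)) ->
  (forall k, nrm (fun x => u_ k.+1 x - u_ k x) <= (2 ^ k.+1)%:R^-1) ->
  {ae m, forall x, cvgn (u_ ^~ x)}.
Proof.
move=> lu du.
pose g k x := `|u_ k.+1 x - u_ k x|.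
have lg k : L2 (fun x => u_ k.+1 x - u_ k x) by exact: L2B.
have mg k : measurable_fun setT (g k).
  exact: L2_measurable (L2_normr (lg k)).
have mG : measurable_fun setT (fun x => \sum_(0 <= k <oo) (g k x)%:E)%E.
  apply: (@ge0_emeasurable_sum _ _ _ setT (fun k x => (g k x)%:E) xpredT).
    by move=> k x _ _; rewrite lee_fin normr_ge0.
  by move=> k _; exact/measurable_EFinP.
have intG : (\int[m]_x (\sum_(0 <= k <oo) (g k x)%:E) < +oo)%E.
  rewrite integral_nneseries; last 3 first.
  - exact: measurableT.
  - by move=> k; exact/measurable_EFinP.
  - by move=> k x _; rewrite lee_fin normr_ge0.
  apply: (@le_lt_trans _ _ (\sum_(0 <= k <oo) (1 / (2 ^ (k + 1))%:R)%:E)%E).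
    apply: lee_nneseries => [k _ _|k _]; first by apply: integral_ge0 => x _; rewrite lee_fin normr_ge0.
    rewrite (le_trans (integral_normr_le_nrm (lg k)))// lee_fin addn1 div1r.
    exact: du.
  have /cvg_lim -> // := @cvg_geometric_eseries_half R 1 0.
  exact: ltry.
have iG : m.-integrable setT (fun x => \sum_(0 <= k <oo) (g k x)%:E)%E.
  apply/integrableP; split => //; apply: le_lt_trans intG.
  rewrite le_eqVlt; apply/orP; left; apply/eqP; apply: eq_integral => x _.
  by rewrite gee0_abs// nneseries_ge0// => k _ _; rewrite lee_fin normr_ge0.
apply: filterS (integrable_ae measurableT iG) => x /(_ I) Gx.
have cd : cvgn (series (telescope (u_ ^~ x))).
  apply: normed_cvg; apply: nondecreasing_is_cvgn; rewrite /=.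
    apply: nondecreasing_series => n _ _; rewrite /=. exact: normr_ge0.
  exists (fine (\sum_(0 <= k <oo) (g k x)%:E)%E) => _ [n _ <-].
  rewrite -lee_fin fineK// /series/= -sumEFin.
  by apply: nneseries_lim_ge => k _; rewrite lee_fin.
rewrite (_ : u_ ^~ x = fun n => u_ 0%N x + series (telescope (u_ ^~ x)) n).
  by apply: is_cvgD => //; exact: is_cvg_cst.
by apply/funext => n; exact: (@eq_sum_telescope _ (u_ ^~ x)).
Qed.

(** The limit is built from the upper limit, so as to be measurable, and
    clamped, so as to be bounded everywhere; dominated convergence then gives
    the convergence in norm. *)
Lemma fast_cauchy_L2_cvg (u_ : nat -> X -> R) : (forall k, L2 (u_ k)) ->
  (forall k, {ae m, forall x, 0 <= u_ k x <= 1}) ->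
  (forall k, nrm (fun x => u_ k.+1 x - u_ k x) <= (2 ^ k.+1)%:R^-1) ->
  exists2 w, L2 w & nrm (fun x => u_ k x - w x) @[k --> \oo] --> 0.
Proof.
move=> lu bu du.
pose w x := clamp (fine (limn_esup (fun k => (u_ k x)%:E))).
have w01 x : 0 <= w x <= 1 by exact: clamp01.
have mw : measurable_fun setT w.
  apply: measurableT_comp; first exact: measurable_clamp.
  apply: measurableT_comp => //.
  apply: (@measurable_fun_limn_esup _ _ _ _ (fun k x => (u_ k x)%:E)) => k.
  exact/measurable_EFinP/L2_measurable.
have lw : L2 w by exact: (L2_01 m1 mw w01).
exists w => //.
pose F k x := ((u_ k x - w x) ^+ 2)%:E.
have ae01 : {ae m, forall x, forall k, 0 <= u_ k x <= 1}.
  by apply/ae_foralln.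
have [] := @dominated_convergence _ _ _ m setT measurableT F (cst 0%E) (cst 1%E).
- move=> k; apply/measurable_EFinP/measurable_funX/measurable_funB => //.
  exact: L2_measurable.
- exact: measurable_cst.
- have := fast_cauchy_ae_cvg lu du; apply: filterS2 ae01 => x u01 cu _.
  have := cu; move/cvg_ex => [l ul].
  have l01 : 0 <= l <= 1.
    apply/andP; split.
      by apply: (cvgr_to_ge ul); apply: nearW => k; case/andP: (u01 k).
    by apply: (cvgr_to_le ul); apply: nearW => k; case/andP: (u01 k).
  have wl : w x = l.
    rewrite /w (_ : limn_esup _ = l%:E) /=; first exact: clamp_id.
    have ue : (u_ k x)%:E @[k --> \oo] --> l%:E by apply: cvg_EFin => //; exact: nearW.
    rewrite is_cvg_limn_esupE; first exact/cvg_lim.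
    by apply/cvg_ex; exists l%:E.
  rewrite /F /= -[0%E]/(0%R%:E); apply: cvg_EFin; first exact: nearW.
  rewrite /comp/= (_ : 0%R = (l - l) ^+ 2); last by rewrite subrr expr0n.
  have ul' : u_ k x - w x @[k --> \oo] --> l - l.
    by rewrite wl; apply: cvgB => //; exact: cvg_cst.
  by rewrite expr2; apply: cvgM.
- have -> : cst 1%E = EFin \o @cst X R 1 by [].
  by apply: (L2_integrable m1); exact: (L2_cst m1).
- apply: filterS ae01 => x u01 k _.
  rewrite /F /= ger0_norm ?sqr_ge0// lee_fin.
  have /andP[] := w01 x; have /andP[] := u01 k; nra.
move=> _ _; rewrite integral0 => intF.
have : fine (\int[m]_x F k x)%E @[k --> \oo] --> 0 by apply/fine_cvg.
rewrite -[in X in _ -> X]sqrtr0 => int0.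
rewrite (_ : (fun k => _) = Num.sqrt \o (fun k => fine (\int[m]_x F k x)%E)).
  by apply: continuous_cvg => //; exact: sqrt_continuous.
by apply/funext => k.
Qed.

End L2_limit.

(** * Large-time limit of a symmetric conservative semigroup *)

Section ergodic.
Context {d} {X : measurableType d} {R : realType}.
Variable m : {measure set X -> \bar R}.
Hypothesis m1 : m setT = 1%E.
Variable T : R -> (X -> R) -> (X -> R).
Hypothesis msgT : markovian_semigroup m T.
Hypothesis T_1 : conservative m T.
Implicit Types (u v w f g : X -> R).

Local Notation L2 u := (u \in Lfun m 2%:E).
Local Notation ip := (L2inner m).
Local Notation nrm := (nrm m).

Let TL2 t u : 0 < t -> L2 u -> L2 (T t u). Proof. exact: (msg_L2 msgT). Qed.

Lemma T_cst c t : 0 < t -> T t (cst c) = cst c %[ae m].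
Proof.
move=> t0.
(* the linearity axiom concerns a u + v: take u = v = 1 and a = c - 1 *)
have h := msg_linear msgT (c - 1) t0 (L2_cst m1 1) (L2_cst m1 1).
rewrite (_ : (fun x => (c - 1) * cst 1 x + cst 1 x) = cst c) in h; last first.
  by apply/funext => x /=; rewrite mulr1 subrK.
apply: filterS2 h (T_1 t0) => x + + _ => /(_ I) -> /(_ I) ->.
by rewrite /= mulr1 subrK.
Qed.

(** A symmetric operator that fixes 1 preserves the mean. *)
Lemma T_ip1 t u : 0 < t -> L2 u -> ip (T t u) (cst 1) = ip u (cst 1).
Proof.
move=> t0 lu; rewrite (msg_symmetric msgT)//; last exact: L2_cst.
have l1 := L2_cst m1 1.
exact: (ip_ae lu lu (TL2 t0 l1) l1 (ae_eq_refl _ _ _) (T_1 t0)).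
Qed.

Let a w s := ip (T s w) (T s w).

(** Symmetry moves the excess of r over (s + r) / 2 to the other side. *)
Lemma ip_TT w s r : L2 w -> 0 < s -> 0 < r ->
  ip (T s w) (T r w) = a w ((s + r) / 2).
Proof.
wlog : s r / s <= r.
  move=> H lw s0 r0; have [sr|/ltW rs] := leP s r; first exact: H.
  by rewrite ipC addrC; exact: H.
move=> + lw s0 r0; rewrite le_eqVlt => /predU1P[->|sr].
  by have -> : (r + r) / 2 = r by lra.
set h := (s + r) / 2; pose e := (r - s) / 2.
have e0 : 0 < e by rewrite divr_gt0// subr_gt0.
have h0 : 0 < h by rewrite divr_gt0// addr_gt0.
have := T_semigroup msgT e0 h0 lw.
have -> : e + h = r by rewrite /e /h; lra.
have ls := TL2 s0 lw; have lr := TL2 r0 lw; have lh := TL2 h0 lw.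
have leh := TL2 e0 lh; have les := TL2 e0 ls.
move=> Tr; rewrite -(ip_ae ls ls leh lr (ae_eq_refl _ _ _) Tr).
rewrite -(msg_symmetric msgT)//.
apply: (ip_ae les lh lh lh _ (ae_eq_refl _ _ _)).
have := T_semigroup msgT e0 s0 lw.
by have -> : e + s = h by rewrite /e /h; lra.
Qed.

Lemma nrm_T_le w s r : L2 w -> 0 < s -> s <= r -> a w r <= a w s.
Proof.
move=> lw s0; rewrite le_eqVlt => /predU1P[->//|sr].
have r0 := lt_trans s0 sr; have rs0 : 0 < r - s by rewrite subr_gt0.
have := T_semigroup msgT rs0 s0 lw; rewrite subrK => h.
have ls := TL2 s0 lw; have lr := TL2 r0 lw; have lrs := TL2 rs0 ls.
rewrite /a -(ip_ae lrs lr lrs lr h h) -!nrm_sqr ler_sqr ?nnegrE ?nrm_ge0//.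
exact: nrm_T.
Qed.

Let ell w := inf [set a w s | s in [set s | 0 < s]].

Let ell_lb w : has_inf [set a w s | s in [set s | 0 < s]].
Proof.
split; first by exists (a w 1); exists 1 => //=.
by exists 0 => _ [s _ <-]; exact: ip_ge0.
Qed.

Let ell_le w s : 0 < s -> ell w <= a w s.
Proof. by move=> s0; apply: ge_inf; [case: (ell_lb w)|exists s]. Qed.

(** ||T_r w - T_s w||^2 = a r + a s - 2 a ((r + s) / 2), where a decreases to
    its infimum [ell w]. *)
Lemma nrm_TBT w s r : L2 w -> 0 < s -> s <= r ->
  nrm (fun x => T r w x - T s w x) <= Num.sqrt (2 * (a w s - ell w)).
Proof.
move=> lw s0 sr; have r0 := lt_le_trans s0 sr.
rewrite ler_wsqrtr// ip_sqrB ?TL2// (ip_TT lw r0 s0).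
have := nrm_T_le lw s0 sr.
have h0 : 0 < (r + s) / 2 by rewrite divr_gt0// addr_gt0.
have := ell_le w h0; rewrite /a; lra.
Qed.

Lemma T_cauchy w e : L2 w -> 0 < e -> exists2 s, 0 < s &
  forall r r', s <= r -> r <= r' ->
    nrm (fun x => T r' w x - T r w x) <= e.
Proof.
move=> lw e0.
have [|_ [s s0 <-] hs] := inf_adherent (eps := e ^+ 2 / 2) _ (ell_lb w).
  by rewrite divr_gt0// exprn_gt0.
exists s => // r r' sr rr'; have r0 := lt_le_trans s0 sr.
apply: (le_trans (nrm_TBT lw r0 rr')).
rewrite -[leRHS]gtr0_norm// -sqrtr_sqr ler_wsqrtr//.
have := nrm_T_le lw s0 sr; move: hs; rewrite -/(ell w); lra.
Qed.

Hypothesis T_fixed_cst : forall w, L2 w ->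
  (forall t, 0 < t -> T t w = w %[ae m]) -> exists c, w = cst c %[ae m].

(** Along a sequence of times that makes the increments summable, T_s w has a
    limit in L^2. This limit is fixed by the semigroup, so it is constant, and
    the constant is the mean of w since T_s preserves the mean. The error
    cannot increase with time, constants being fixed. *)
Lemma T_ergodic w e : L2 w -> {ae m, forall x, 0 <= w x <= 1} -> 0 < e ->
  exists2 s, 0 < s & forall r, s <= r ->
    nrm (fun x => T r w x - \int[m]_y w y) <= e.
Proof.
move=> lw w01 e0.
have /choice[sigma hsigma] : forall k, exists sigma : R, 0 < sigma /\
    forall r r', sigma <= r -> r <= r' ->
      nrm (fun x => T r' w x - T r w x) <= (2 ^ k.+1)%:R^-1.
  move=> k; have [|s s0 hs] := @T_cauchy w (2 ^ k.+1)%:R^-1 lw.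
    by rewrite invr_gt0 ltr0n expn_gt0.
  by exists s.
(* partial sums make the times increase while staying beyond [sigma k] *)
pose S k := \sum_(j < k.+1) sigma j.
have sS k : sigma k <= S k.
  rewrite /S big_ord_recr/= lerDr; apply: sumr_ge0 => j _.
  by apply/ltW; case: (hsigma j).
have S0 k : 0 < S k by apply: lt_le_trans (sS k); case: (hsigma k).
have SS k : S k <= S k.+1.
  by rewrite [leRHS]/S big_ord_recr/= lerDl; apply/ltW; case: (hsigma k.+1).
have lS k : L2 (T (S k) w) by exact: TL2.
have [v lv vlim] := @fast_cauchy_L2_cvg _ _ _ m m1 (fun k => T (S k) w) lS
  (fun k => msg_markovian msgT (S0 k) lw w01)
  (fun k => (hsigma k).2 _ _ (sS k) (SS k)).
have nrmBC f g : L2 f -> L2 g -> nrm (fun x => f x - g x) = nrm (fun x => g x - f x).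
  move=> lf lg; rewrite (_ : (fun x => f x - g x) = fun x => -1 * (g x - f x)).
    by rewrite nrmZ; [rewrite normrN1 mul1r|exact: L2B].
  by apply/funext => x; rewrite mulN1r opprB.
have vfix t : 0 < t -> T t v = v %[ae m].
  move=> t0; have lTv := TL2 t0 lv.
  suff : nrm (fun x => T t v x - v x) <= 0.
    move=> Dt; have {}Dt : nrm (fun x => T t v x - v x) = 0.
      by apply/le_anti; rewrite Dt nrm_ge0.
    have := nrm_eq0 (L2B lTv lv) Dt.
    by apply: filterS => x + _ => /(_ I)/eqP; rewrite subr_eq0 => /eqP.
  have lim0 : (nrm (fun x => T (S k) w x - v x) + ((2 ^ k.+1)%:R^-1 +
     nrm (fun x => T (S k) w x - v x))) @[k --> \oo] --> (0 + (0 + 0) : R).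
    apply: cvgD => //; apply: cvgD => //.
    rewrite (_ : (fun k => _) = (fun k => geometric 2^-1 2^-1 k : R)).
      by apply: cvg_geometric; rewrite ger0_norm// invf_lt1 ?ltr1n.
    by apply/funext => k /=; rewrite natrX exprS invfM exprVn.
  rewrite -[leRHS]addr0 -[X in _ <= _ + X]addr0.
  apply: (cvgr_to_ge lim0); apply: nearW => k.
  have tS0 := addr_gt0 t0 (S0 k); have lSk := lS k.
  have lTS := TL2 tS0 lw; have lTT := TL2 t0 lSk.
  have eTS := T_semigroup msgT t0 (S0 k) lw.
  pose p x := T t v x - T t (T (S k) w) x.
  pose q x := T (t + S k) w x - T (S k) w x.
  have lp : L2 p by exact: L2B.
  have lq : L2 q by exact: L2B.
  have l3 : L2 (fun x => T (S k) w x - v x) by exact: L2B.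
  have -> : nrm (fun x => T t v x - v x) =
      nrm (fun x => p x + (q x + (T (S k) w x - v x))).
    apply: nrm_ae; [exact: L2B|exact: L2D lp (L2D lq l3)|].
    apply: filterS eTS => x + _ => /(_ I) eq.
    by rewrite /p /q eq; lra.
  apply: (le_trans (nrmD m1 lp (L2D lq l3))); apply: lerD.
    by rewrite (nrmBC _ _ lSk lv); exact: nrm_TB.
  apply: (le_trans (nrmD m1 lq l3)); rewrite lerD2r.
  by apply: (hsigma k).2 => //; rewrite lerDr ltW.
have [c vc] := T_fixed_cst lv vfix.
have lc := L2_cst m1 c; have l1 := L2_cst m1 1.
have cE : c = \int[m]_y w y.
  have ipv : ip v (cst 1) = c.
    rewrite (ip_ae lv lc l1 l1 vc (ae_eq_refl _ _ _)) ip_cst1 Rintegral_cst//.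
    by rewrite m1 mulr1.
  apply/eqP; rewrite -subr_eq0 -normr_le0 -ip_cst1 -ipv.
  apply: (cvgr_to_ge vlim); apply: nearW => k.
  rewrite -(T_ip1 (S0 k) lw) -ipBl// (nrmBC _ _ (lS k) lv).
  have lvS := L2B lv (lS k).
  by have := ip_le_nrm m1 lvS l1; rewrite nrm1// mulr1.
have /cvgrPdist_le/(_ _ e0)[N _ hN] := vlim.
exists (S N) => // r; rewrite -cE le_eqVlt => /predU1P[<-|Sr].
  have := hN N (leqnn N); rewrite /= sub0r normrN => /(le_trans (ler_norm _)).
  rewrite (@nrm_ae _ _ _ m _ (fun x => T (S N) w x - c)) => //.
  - exact: L2B.
  - exact: L2B (lS N) lc.
  - by apply: filterS vc => x + _ => /(_ I) ->.
have rS0 : 0 < r - S N by rewrite subr_gt0.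
have r0 := lt_trans (S0 N) Sr.
have lTc := TL2 rS0 lc; have lTTS := TL2 rS0 (lS N); have lTr := TL2 r0 lw.
have := T_semigroup msgT rS0 (S0 N) lw; rewrite subrK => eTr.
have -> : nrm (fun x => T r w x - c) =
    nrm (fun x => T (r - S N) (T (S N) w) x - T (r - S N) (cst c) x).
  apply: nrm_ae; [exact: L2B lTr lc|exact: L2B|].
  by apply: filterS2 eTr (T_cst c rS0) => x + + _ => /(_ I) -> /(_ I) ->.
apply: (le_trans (nrm_TB msgT rS0 (lS N) lc)).
have := hN N (leqnn N); rewrite /= sub0r normrN => /(le_trans (ler_norm _)).
rewrite (@nrm_ae _ _ _ m _ (fun x => T (S N) w x - cst c x)) => //.
- exact: L2B.
- exact: L2B.
- by apply: filterS vc => x + _ => /(_ I) ->.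
Qed.

End ergodic.

(** * Integrals of arbitrary functions *)

Section le_integral.
Context {d} {X : measurableType d} {R : realType}.
Variable mu : {measure set X -> \bar R}.

(** The integral of a nonnegative function is the supremum of the integrals of
    the simple functions below it, hence is monotone whatever the functions
    are. This matters for functions known through their values only: a function
    of time defined by integrals in space, or a representative of a class. *)
Lemma ge0_le_integral_nonmeasurable (D : set X) (f g : X -> \bar R) :
  (forall x, D x -> 0 <= f x)%E -> (forall x, D x -> f x <= g x)%E ->
  (\int[mu]_(x in D) f x <= \int[mu]_(x in D) g x)%E.
Proof.
move=> f0 fg; have g0 x : D x -> (0 <= g x)%E.
  by move=> Dx; apply: le_trans (f0 _ Dx) (fg _ Dx).
rewrite !ge0_integralE//; apply: le_ereal_sup => _ [h hf <-]; exists h => // x.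
apply: le_trans (hf x) _; rewrite /patch; case: ifPn => // xD.
exact/fg/set_mem.
Qed.

End le_integral.

Section ae_eq_nonmeasurable.
Context {d} {X : measurableType d} {R : realType}.
Variable mu : {measure set X -> \bar R}.
Implicit Types f g : X -> \bar R.

(** Modifying g on the exceptional null set N gives measurable functions above
    and below f, with the integral of g. *)
Lemma ge0_ae_eq_integral_nonmeasurable f g : measurable_fun setT g ->
  (forall x, 0 <= f x)%E -> (forall x, 0 <= g x)%E -> f = g %[ae mu] ->
  (\int[mu]_x f x = \int[mu]_x g x)%E.
Proof.
move=> mg f0 g0 [N [mN N0 fgN]].
have fg x : ~ N x -> f x = g x by move=> nN; apply: contrapT => h; apply/nN/fgN => /(_ I).
apply/eqP; rewrite eq_le; apply/andP; split.
  pose g' x := if x \in N then +oo%E else g x.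
  have mg' : measurable_fun setT g'.
    apply: measurable_fun_ifT => //.
    apply: (measurable_fun_bool true); rewrite setTI.
    by rewrite (_ : _ @^-1` _ = N)//; apply/seteqP; split=> x /=; [exact: set_mem|exact: mem_set].
  rewrite -(@ge0_ae_eq_integral _ _ _ mu setT g' g) //.
  - apply: ge0_le_integral_nonmeasurable => // x _; rewrite /g'.
    by case: ifPn => [_|/negP xN]; [rewrite leey|rewrite fg// => /mem_set].
  - by move=> x _; rewrite /g'; case: ifPn.
  - exists N; split => // x /= h; apply: contrapT => nN; apply: h => _.
    by rewrite /g' ifN//; apply/negP => /set_mem.
pose g' x := if x \in N then 0%E else g x.
have mg' : measurable_fun setT g'.
  apply: measurable_fun_ifT => //.
  apply: (measurable_fun_bool true); rewrite setTI.
  by rewrite (_ : _ @^-1` _ = N)//; apply/seteqP; split=> x /=; [exact: set_mem|exact: mem_set].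
rewrite (@ge0_ae_eq_integral _ _ _ mu setT g g') //.
- apply: ge0_le_integral_nonmeasurable => // x _; rewrite /g'; case: ifPn => //.
  by move=> /negP xN; rewrite fg// => /mem_set.
- by move=> x _; rewrite /g'; case: ifPn.
- exists N; split => // x /= h; apply: contrapT => nN; apply: h => _.
  by rewrite /g' ifN//; apply/negP => /set_mem.
Qed.

Lemma ae_eq_Rintegral_nonmeasurable (f g : X -> R) : measurable_fun setT g ->
  f = g %[ae mu] -> \int[mu]_x f x = \int[mu]_x g x.
Proof.
move=> /measurable_EFinP mg fg; congr fine; rewrite integralE [RHS]integralE.
have /ae_eq_funeposneg[hp hn] : ae_eq mu setT (EFin \o f) (EFin \o g).
  by apply: filterS fg => x + _ => /(_ I) /= ->.
congr (_ - _)%E; apply: ge0_ae_eq_integral_nonmeasurable => //.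
- exact: measurable_funepos.
- exact: measurable_funeneg.
Qed.

End ae_eq_nonmeasurable.

(** * Recurrence *)

Section recurrence.
Context {d} {X : measurableType d} {R : realType}.
Variable m : {measure set X -> \bar R}.
Hypothesis m1 : m setT = 1%E.
Variable T : R -> (X -> R) -> (X -> R).
Hypothesis msgT : markovian_semigroup m T.
Hypothesis T_1 : conservative m T.
Implicit Types (u v w f g h : X -> R).

Local Notation L1 u := (u \in Lfun m 1%E).
Local Notation L2 u := (u \in Lfun m 2%:E).
Local Notation ip := (L2inner m).
Local Notation nrm := (nrm m).

Let TL2 t u : 0 < t -> L2 u -> L2 (T t u). Proof. exact: (msg_L2 msgT). Qed.

Lemma integrable_mul01 h v : m.-integrable setT (EFin \o h) ->
  measurable_fun setT v -> (forall x, 0 <= v x <= 1) ->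
  m.-integrable setT (EFin \o (fun x => h x * v x)).
Proof.
move=> ih mv v01; apply: (le_integrable measurableT _ _ ih).
  apply/measurable_EFinP/measurable_funM => //.
  exact/measurable_EFinP/(measurable_int m).
move=> x _; rewrite /= lee_fin normrM ler_piMr//.
by have /andP[v0 v1] := v01 x; rewrite ger0_norm.
Qed.

Lemma Rintegral_mul01_le h v : L1 h ->
  measurable_fun setT v -> (forall x, 0 <= v x <= 1) ->
  `|\int[m]_x (h x * v x)| <= fine (Lpnorm m 1%E h).
Proof.
move=> /Lfun1_integrable ih mv v01.
have ihv := integrable_mul01 ih mv v01.
apply: le_trans (le_normr_Rintegral measurableT ihv) _.
rewrite /Lpnorm Lnorm1 -/(Rintegral _ _ (fun x => `|h x|)).
apply: le_Rintegral => //; [exact: integrable_norm|exact: integrable_norm|].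
move=> x _; rewrite /= normrM ler_piMr//.
by have /andP[v0 v1] := v01 x; rewrite ger0_norm.
Qed.

Lemma ae01_version u : L2 u -> {ae m, forall x, 0 <= u x <= 1} ->
  exists v, [/\ measurable_fun setT v, (forall x, 0 <= v x <= 1) &
    u = v %[ae m]].
Proof.
move=> lu u01; exists (fun x => clamp (u x)); split.
- exact: measurableT_comp measurable_clamp (L2_measurable lu).
- by move=> x; exact: clamp01.
- by apply: filterS u01 => x ux _; rewrite clamp_id.
Qed.

Lemma Rintegral_indicr f (A : set X) : measurable A ->
  \int[m]_(x in A) f x = \int[m]_x (f x * \1_A x).
Proof.
move=> mA; rewrite Rintegral_mkcond; apply: eq_Rintegral => x _.
by rewrite patchE indicE; case: ifPn => xA; rewrite ?mulr1 ?mulr0.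
Qed.

(** The symmetry of T_s on L^2 carries over to the extension of T_s to L^1,
    with the bounded function T_s 1_A in the other slot; [v] is a version of
    T_s 1_A with values in [0, 1] everywhere, which makes the products with
    integrable functions integrable. *)
Lemma L1_extension_dual s f g (A : set X) v : 0 < s -> measurable A ->
  L1_extension m (T s) f g ->
  measurable_fun setT v -> (forall x, 0 <= v x <= 1) -> T s \1_A = v %[ae m] ->
  \int[m]_(x in A) g x = \int[m]_x (f x * v x).
Proof.
move=> s0 mA [l1f l1g [f_ [l1f_ l2f_ f_f Tf_g]]] mv v01 Tv.
have lA := L2_indic m1 mA; have lv := L2_01 m1 mv v01.
have A01 x : 0 <= (\1_A x : R) <= 1 by exact: indic01.
have mA1 : measurable_fun setT (\1_A : X -> R) by exact: measurable_indic.
have eT n : ip (T s (f_ n)) \1_A = ip (f_ n) v.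
  rewrite (msg_symmetric msgT)//.
  exact: (ip_ae (l2f_ n) (l2f_ n) (TL2 s0 lA) lv (ae_eq_refl _ _ _) Tv).
have L1i u : L1 u -> m.-integrable setT (EFin \o u) by move/Lfun1_integrable.
have L1T n : L1 (T s (f_ n)).
  by apply/Lfun1_integrable/(L2_integrable m1)/TL2.
apply/eqP; rewrite -subr_eq0 -normr_le0.
have lim0 : (fine (Lpnorm m 1%E (T s (f_ n) \- g)) +
    fine (Lpnorm m 1%E (f_ n \- f))) @[n --> \oo] --> (0 + 0 : R).
  by apply: cvgD; apply/fine_cvg.
rewrite -[leRHS]addr0; apply: (cvgr_to_ge lim0); apply: nearW => n.
rewrite Rintegral_indicr//.
have L1B u u' : L1 u -> L1 u' -> L1 (u \- u').
  move=> /L1i iu /L1i iu'; apply/Lfun1_integrable.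
  by have := integrableB measurableT iu iu'.
have B u u' w : L1 u -> L1 u' -> measurable_fun setT w -> (forall x, 0 <= w x <= 1) ->
    \int[m]_x ((u \- u') x * w x) = \int[m]_x (u x * w x) - \int[m]_x (u' x * w x).
  move=> lu lu' mw w01; rewrite -RintegralB//; last 2 first.
  - by apply: integrable_mul01 => //; exact: L1i.
  - by apply: integrable_mul01 => //; exact: L1i.
  by apply: eq_Rintegral => x _; rewrite /= mulrBl.
have h1 := Rintegral_mul01_le (L1B _ _ (L1T n) l1g) mA1 A01.
have h2 := Rintegral_mul01_le (L1B _ _ (l1f_ n) l1f) mv v01.
have eTn : \int[m]_x (T s (f_ n) x * \1_A x) = \int[m]_x (f_ n x * v x) := eT n.
rewrite B// eTn in h1; rewrite B// in h2.
apply: le_trans (ler_distD (\int[m]_x (f_ n x * v x)) _ _) _.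
by rewrite distrC; exact: lerD h1 h2.
Qed.

Lemma time_integral_dual f t S (A : set X) (psi : R -> R) : measurable A ->
  time_integral m T f t S ->
  (forall s, 0 < s -> exists v, [/\ measurable_fun setT v,
     (forall x, 0 <= v x <= 1), T s \1_A = v %[ae m] &
     psi s = \int[m]_x (f x * v x)]) ->
  \int[m]_(x in A) S x = \int[lebesgue_measure]_(s in `]0, t]) psi s.
Proof.
move=> mA [Tf hTf [_ ->//]] hpsi; apply: eq_Rintegral => s.
rewrite inE/= in_itv/= => /andP[s0 _].
have [v [mv v01 Tv ->]] := hpsi _ s0.
exact: L1_extension_dual s0 mA (hTf _ s0) mv v01 Tv.
Qed.

(** Both bounds compare [psi], given by its values only, with constants: the
    monotonicity of the integral of arbitrary functions applies. *)
Lemma Rintegral_itv_ge (psi : R -> R) (M delta s0 t : R) : 0 <= s0 -> s0 <= t ->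
  0 <= delta -> (forall s, 0 < s -> 0 <= psi s <= M) ->
  (forall s, s0 < s -> delta <= psi s) ->
  delta * (t - s0) <= \int[lebesgue_measure]_(s in `]0, t]) psi s.
Proof.
move=> s00 s0t d0 psiM psid; rewrite /Rintegral -lee_fin.
have t0 := le_trans s00 s0t.
have leb a b : a <= b -> lebesgue_measure (`]a, b] : set R) = (b - a)%:E.
  move=> ab; rewrite lebesgue_measure_itv/= lte_fin.
  by case: ltgtP ab => // -> _; rewrite subrr.
have psi0 s : `]0, t]%classic s -> (0 <= (psi s)%:E)%E.
  by rewrite /= in_itv/= lee_fin => /andP[/psiM/andP[]].
rewrite fineK.
  rewrite EFinM -leb// -integral_cst//.
  rewrite integral_mkcond [leRHS]integral_mkcond.
  apply: ge0_le_integral_nonmeasurable => s _; rewrite /patch.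
    by case: ifPn.
  case: ifPn => [|_].
    rewrite inE/= in_itv/= => /andP[ss0 st].
    by rewrite ifT ?lee_fin ?psid// inE/= in_itv/= st (le_lt_trans s00 ss0).
  by case: ifPn => // /set_mem /psi0.
rewrite ge0_fin_numE; last exact: integral_ge0.
apply: (@le_lt_trans _ _ (\int[lebesgue_measure]_(s in `]0%R, t]) M%:E)%E).
  apply: ge0_le_integral_nonmeasurable => // s /=.
  by rewrite in_itv/= lee_fin => /andP[/psiM/andP[]].
by rewrite integral_cst//= leb// -EFinM ltry.
Qed.

Hypothesis T_fixed_cst : forall w, L2 w ->
  (forall t, 0 < t -> T t w = w %[ae m]) -> exists c, w = cst c %[ae m].

(** T_s 1_A tends to the constant m A in L^2, so the pairing with an f of L^2
    tends to m A times the integral of f. An f of L^1 is replaced by its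
    truncation at 1, which bounds it from below and has a positive integral
    too; half the limit is the lower bound. *)
Lemma Rintegral_T_indic_ge f (A : set X) : L1 f -> {ae m, forall x, 0 <= f x} ->
  0 < \int[m]_x f x -> measurable A -> (0 < m A)%E ->
  exists delta s0 : R, [/\ 0 < delta, 0 < s0 & forall s v, s0 <= s ->
    measurable_fun setT v -> (forall x, 0 <= v x <= 1) -> T s \1_A = v %[ae m] ->
    delta <= \int[m]_x (f x * v x)].
Proof.
move=> l1f f0 If mA mA0.
have iff : m.-integrable setT (EFin \o f) by move/Lfun1_integrable: l1f.
have mf : measurable_fun setT f by exact/measurable_EFinP/(measurable_int m).
pose f1 x := clamp (f x).
have f101 x : 0 <= f1 x <= 1 by exact: clamp01.
have mf1 : measurable_fun setT f1 by exact: measurableT_comp measurable_clamp mf.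
have lf1 := L2_01 m1 mf1 f101.
have if1 := L2_integrable m1 lf1.
have I1 : 0 < \int[m]_x f1 x.
  rewrite lt_neqAle Rintegral_ge0 ?andbT; last by move=> x _; case/andP: (f101 x).
  apply/negP => /eqP/esym If1.
  have f1e := ge0_Rintegral_eq0 (fun x => proj1 (andP (f101 x))) if1 If1.
  suff f_0 : f = cst 0 %[ae m].
    by move: If; rewrite (ae_eq_Rintegral mf _ f_0)// Rintegral_cst// mul0r ltxx.
  apply: filterS2 f0 f1e => x fx0 + _ => /(_ I).
  rewrite /f1 /clamp /= maxElt minElt; case: ifPn; case: ifPn => //; lra.
have lA := L2_indic m1 mA.
have A01 x : 0 <= (\1_A x : R) <= 1 by exact: indic01.
have mAfin : m A \is a fin_num.
  rewrite ge0_fin_numE//; apply: le_lt_trans (ltry 1).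
  by rewrite -m1 le_measure ?inE.
have IA : \int[m]_x \1_A x = fine (m A).
  by rewrite /Rintegral integral_indic// setIT.
(* [a] is the limit of the pairing; [e] makes the Cauchy-Schwarz error at most a / 2 *)
pose a := fine (m A) * \int[m]_x f1 x.
have fA0 : 0 < fine (m A) by rewrite fine_gt0// mA0 -ge0_fin_numE.
have a0 : 0 < a by rewrite mulr_gt0.
pose e := a / 2 / (nrm f1 + 1).
have n0 : 0 < nrm f1 + 1 by rewrite ltr_wpDl ?nrm_ge0.
have e0 : 0 < e by rewrite /e !divr_gt0.
have [s0 s00 hs0] := T_ergodic m1 msgT T_1 T_fixed_cst lA (aeW _ A01) e0.
exists (a / 2), s0; split => //; first by rewrite divr_gt0.
move=> s v s0s mv v01 Tv.
have s_0 := lt_le_trans s00 s0s.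
have lv := L2_01 m1 mv v01.
have lTA := TL2 s_0 lA.
have lc := L2_cst m1 (fine (m A)).
have h : `|ip f1 (fun x => v x - cst (fine (m A)) x)| <= a / 2.
  apply: le_trans (ip_le_nrm m1 lf1 (L2B lv lc)) _.
  have := hs0 s s0s; rewrite IA.
  rewrite (@nrm_ae _ _ _ m _ (fun x => v x - cst (fine (m A)) x)); last 3 first.
  - exact: L2B lTA lc.
  - exact: L2B lv lc.
  - by apply: filterS Tv => x + _ => /(_ I) ->.
  move=> hn; apply: le_trans (ler_wpM2l (nrm_ge0 _ _) hn) _.
  rewrite /e mulrCA ger_pMr ?divr_gt0// ler_pdivrMr// mul1r; lra.
rewrite ipBr// in h.
have ipc : ip f1 (cst (fine (m A))) = a.
  by rewrite /L2inner RintegralZr// mulrC.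
rewrite ipc in h.
have hle : ip f1 v <= \int[m]_x (f x * v x).
  have i1 := L2_ip lf1 lv; have i2 := integrable_mul01 iff mv v01.
  rewrite -subr_ge0 -RintegralB//.
  have mm : measurable_fun setT (fun x => f x * v x - f1 x * v x).
    by apply: measurable_funB; exact: measurable_funM.
  rewrite (@ae_eq_Rintegral _ _ _ m _ (fun x => `|f x * v x - f1 x * v x|)) //.
  - by apply: Rintegral_ge0.
  - exact: measurableT_comp.
  - apply: filterS f0 => x fx0 _; rewrite ger0_norm// -mulrBl mulr_ge0//.
      by rewrite subr_ge0 /f1 /clamp ge_max fx0 ge_min lexx orbT.
    by case/andP: (v01 x).
move: h; rewrite ler_norml => /andP[+ _]; lra.
Qed.

(** If f is null then so is its potential. Otherwise let A k be the set where
    all the time integrals S N with N >= k are at most k. The integral of S N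
    over A k is at most k m (A k), yet it grows linearly with N unless A k is
    null. So almost no point is in some A k, that is, the potential is
    infinite almost everywhere. *)
Theorem ergodic_recurrent : recurrent m T.
Proof.
move=> f h l1f f0 [mh [S hS Sh]].
have iff : m.-integrable setT (EFin \o f) by move/Lfun1_integrable: l1f.
have mf : measurable_fun setT f by exact/measurable_EFinP/(measurable_int m).
(* [psi A s] is the pairing of f with a [0, 1]-valued version of T_s 1_A *)
have [psi hpsi] : exists psi : set X -> R -> R, forall A s, measurable A -> 0 < s ->
    exists v, [/\ measurable_fun setT v,
     (forall x, 0 <= v x <= 1), T s \1_A = v %[ae m] &
     psi A s = \int[m]_x (f x * v x)].
  suff /choice[psi Hpsi] : forall As : set X * R, exists y : R,
      measurable As.1 -> 0 < As.2 -> exists v, [/\ measurable_fun setT v,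
     (forall x, 0 <= v x <= 1), T As.2 \1_(As.1) = v %[ae m] &
     y = \int[m]_x (f x * v x)].
    by exists (fun A s => psi (A, s)) => A s mA s0; exact: (Hpsi (A, s)).
  move=> [A s] /=; have [[mA s0]|nh] := pselect (measurable A /\ 0 < s); last first.
    by exists 0 => mA s0; exfalso; exact: nh.
  have lA := L2_indic m1 mA.
  have A01 x : 0 <= (\1_A x : R) <= 1 by exact: indic01.
  have [v [mv v01 Tv]] := ae01_version (TL2 s0 lA) (msg_markovian msgT s0 lA (aeW _ A01)).
  by exists (\int[m]_x (f x * v x)) => _ _; exists v.
have SA N (A : set X) : measurable A ->
    \int[m]_(x in A) S N x = \int[lebesgue_measure]_(s in `]0, N%:R]) psi A s.
  move=> mA; apply: time_integral_dual (hS N) _ => // s s0; exact: hpsi.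
have l1S N : L1 (S N) by case: (hS N) => ? _ [].
have iS N : m.-integrable setT (EFin \o S N) by move/Lfun1_integrable: (l1S N).
have mS N : measurable_fun setT (S N) by exact/measurable_EFinP/(measurable_int m).
have M0 : 0 <= \int[m]_x f x.
  rewrite (@ae_eq_Rintegral _ _ _ m _ (fun x => `|f x|)) ?Rintegral_ge0//.
    exact: measurableT_comp.
  by apply: filterS f0 => x fx0 _; rewrite ger0_norm.
have psiM A s : measurable A -> 0 < s -> 0 <= psi A s <= \int[m]_x f x.
  move=> mA s0; have [v [mv v01 _ ->]] := hpsi A s mA s0.
  have i2 := integrable_mul01 iff mv v01.
  have mfv : measurable_fun setT (fun x => f x * v x) by exact: measurable_funM.
  rewrite (@ae_eq_Rintegral _ _ _ m (fun x => f x * v x) (fun x => `|f x * v x|)) //; last 2 first.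
  - exact: measurableT_comp.
  - by apply: filterS f0 => x fx0 _; rewrite ger0_norm// mulr_ge0//; case/andP: (v01 x).
  rewrite (@ae_eq_Rintegral _ _ _ m f (fun x => `|f x|)) //; last 2 first.
  - exact: measurableT_comp.
  - by apply: filterS f0 => x fx0 _; rewrite ger0_norm.
  rewrite Rintegral_ge0//=; apply: le_Rintegral => //; [exact: integrable_norm|exact: integrable_norm|].
  move=> x _; rewrite normrM ler_piMr// ger0_norm//; by case/andP: (v01 x).
move: M0; rewrite le_eqVlt => /predU1P[M0|M0].
  have S0 N : S N = cst 0 %[ae m].
    have /= : ae_eq m setT (EFin \o S N) (EFin \o cst 0).
      apply: integral_ae_eq; [exact: measurableT|exact: iS|exact/measurable_EFinP/measurable_cst|].
      move=> A _ mA.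
      rewrite -(fineK (integrable_fin_num mA (integrableS measurableT mA (@subsetT _ _) (iS N)))).
      rewrite -[fine _]/(\int[m]_(x in A) S N x) SA//.
      under eq_Rintegral.
        move=> s; rewrite inE/= in_itv/= => /andP[s0 _].
        have := psiM A s mA s0; rewrite -M0 => /le_anti <-; over.
      by rewrite Rintegral_cst// mul0r integral0.
    by apply: filterS => x + _ => /(_ I) [].
  have {}S0 : {ae m, forall x, forall N, S N x = 0}.
    by apply/ae_foralln => N; apply: filterS (S0 N) => x /(_ I).
  apply: filterS2 S0 Sh => x Sx0 Sxh; left.
  apply: (cvg_unique _ Sxh); first exact: ereal_hausdorff.
  rewrite (_ : (fun N => (S N x)%:E) = cst 0%E); first exact: cvg_cst.
  by apply/funext => N; rewrite Sx0.
pose A k := \bigcap_(N in [set N | (k <= N)%N]) [set x | S N x <= k%:R].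
have mA k : measurable (A k).
  apply: bigcap_measurable => [|N _]; first by exists k => /=.
  rewrite [X in measurable X](_ : _ = setT `&` S N @^-1` `]-oo, k%:R]).
    by apply: mS => //; exact: measurable_itv.
  by rewrite setTI; apply/seteqP; split=> x /=; rewrite in_itv.
have A0 k : m (A k) = 0%E.
  apply/eqP; apply: contraT => mAk0.
  have {}mAk0 : (0 < m (A k))%E by rewrite lt0e mAk0 measure_ge0.
  have [delta [s0 [d0 s00 hd]]] := Rintegral_T_indic_ge l1f f0 M0 (mA k) mAk0.
  have kfin : m (A k) \is a fin_num.
    rewrite ge0_fin_numE//; apply: le_lt_trans (ltry 1).
    by rewrite -m1 le_measure ?inE.
  have up N : (k <= N)%N -> s0 <= N%:R -> delta * (N%:R - s0) <= k%:R * fine (m (A k)).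
    move=> kN s0N; apply: (@le_trans _ _ (\int[m]_(x in A k) S N x)).
      rewrite SA//; apply: (@Rintegral_itv_ge _ (\int[m]_x f x)) => //; [exact: ltW|exact: ltW| |].
        by move=> s s_0; exact: psiM.
      move=> s s0s; have s_0 := lt_trans s00 s0s.
      have [v [mv v01 Tv ->]] := hpsi (A k) s (mA k) s_0.
      by apply: (hd s) => //; exact: ltW.
    rewrite -Rintegral_cst//; apply: le_Rintegral => //.
    - by apply: integrableS (iS N).
    - apply: measurable_bounded_integrable => //; first by rewrite -ge0_fin_numE.
      exact: bounded_cst.
    - by move=> x; apply.
  (* N is past s0 and k, and delta (N - s0) exceeds k m (A k) *)
  have [N hN] : exists N : nat, s0 + k%:R + (k%:R * fine (m (A k)) + 1) / delta <= N%:R.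
    exists (Num.truncn (s0 + k%:R + (k%:R * fine (m (A k)) + 1) / delta)).+1.
    by rewrite ltW// truncnS_gt.
  have q0 : 0 <= (k%:R * fine (m (A k)) + 1) / delta.
    by rewrite divr_ge0 ?addr_ge0 ?mulr_ge0 ?fine_ge0// ltW.
  have kN : (k <= N)%N by rewrite -(ler_nat R); lra.
  have s0N : s0 <= N%:R by have : 0 <= k%:R :> R by []; lra.
  have := up N kN s0N; rewrite leNgt => /negP[].
  rewrite -ltr_pdivrMl// mulrC; apply: (@lt_le_trans _ _ ((k%:R * fine (m (A k)) + 1) / delta)).
    by rewrite ltr_pdivrMr// divfK ?gt_eqF// ltrDl.
  have : 0 <= k%:R :> R by []; lra.
have {}A0 : {ae m, forall x, forall k, ~ A k x}.
  apply/ae_foralln => k; exists (A k); split => //.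
  by move=> x /= /contrapT.
apply: filterS2 A0 Sh => x nA Sxh; right.
have [//|hlt] := eqVneq (h x) +oo%E; exfalso.
have {}hlt : (h x < +oo)%E by rewrite ltey.
(* a finite limit below r puts x in A k as soon as k is past r and past the
   index from which S N x < r *)
have [r hr] : exists r : R, (h x < r%:E)%E.
  move: hlt; case: (h x) => [y _| //|_]; last by exists 0; rewrite ltNyr.
  by exists (y + 1); rewrite lte_fin ltrDl.
have : \forall N \near \oo, ((S N x)%:E < r%:E)%E.
  exact: (Sxh _ (open_ereal_lt' hr)).
move=> [N0 _ hN0].
apply: (nA (maxn N0 (Num.truncn r).+1)) => N /=; rewrite geq_max => /andP[N0N rN].
have := hN0 N N0N; rewrite /= lte_fin => /ltW/le_trans; apply.
apply: (@le_trans _ _ (Num.truncn r).+1%:R); first by rewrite ltW// truncnS_gt.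
by rewrite ler_nat leq_maxr.
Qed.

End recurrence.

(** * Irreducibility *)

Section irreducibility.
Context {d} {X : measurableType d} {R : realType}.
Variable m : {measure set X -> \bar R}.
Hypothesis m1 : m setT = 1%E.
Variable T : R -> (X -> R) -> (X -> R).
Hypothesis T_1 : conservative m T.
Hypothesis T_fixed_cst : forall w, w \in Lfun m 2%:E ->
  (forall t, 0 < t -> T t w = w %[ae m]) -> exists c, w = cst c %[ae m].

(** Invariance applied to f = 1 says that the indicator is fixed; an indicator
    that is constant almost everywhere belongs to a null or conull set. *)
Lemma fixed_cst_irreducible : irreducible m T.
Proof.
move=> B [mB TB].
have [t t0|c Bc] := T_fixed_cst (L2_indic m1 mB).
  have := TB t (cst 1) t0 (L2_cst m1 1).
  rewrite (_ : \1_B \* cst 1 = \1_B); last by apply/funext => x /=; rewrite mulr1.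
  move=> h; apply: filterS2 h (T_1 t0) => x + + _ => /(_ I) -> /(_ I) /= ->.
  by rewrite mulr1.
have [c1|c1] := eqVneq c 1.
  right; apply/(negligibleP _ (measurableC mB)).
  apply: negligibleS Bc => x /= nB /(_ I) /eqP.
  by rewrite c1 indicE memNset//= eq_sym oner_eq0.
left; apply/(negligibleP _ mB); apply: negligibleS Bc => x /= Bx /(_ I) /esym/eqP.
by rewrite indicE mem_set//= (negbTE c1).
Qed.

End irreducibility.

(** * Integrals on the line *)

Section line_integrals.
Context {R : realType}.
Local Notation mu := (@lebesgue_measure R).
Implicit Types (f : R -> \bar R) (a c : R).

(** By uniqueness of the Lebesgue measure, it is a times its own image under
    x |-> a x, since the two agree on intervals. *)
Lemma ge0_integral_scale f a : 0 < a -> measurable_fun setT f ->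
  (forall x, 0 <= f x)%E ->
  (\int[mu]_x f x = a%:E * \int[mu]_x f (a * x)%R)%E.
Proof.
move=> a0 mf f0.
pose phi : measurableTypeR R -> measurableTypeR R := fun x => a * x.
have mphi : measurable_fun setT phi.
  exact: measurable_funM.
have scale A : measurable A ->
    mu A = mscale (NngNum (ltW a0)) (pushforward mu phi) A.
  move=> mA; apply: lebesgue_measure_unique mA => _ [[u v]] /= _ <-.
  have phiE : phi @^-1` `]u, v] = `]a^-1 * u, a^-1 * v]%classic.
    apply/seteqP; split=> x /=; rewrite !in_itv/= => /andP[].
      by move=> h1 h2; rewrite ltr_pdivrMl// h1 ler_pdivlMl.
    by rewrite ltr_pdivrMl// ler_pdivlMl// => -> ->.
  transitivity (a%:E * mu (`](a^-1 * u)%R, (a^-1 * v)%R]%classic : set R))%E; last by rewrite -phiE.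
  rewrite !lebesgue_measure_itv/= !lte_fin ltr_pM2l ?invr_gt0//.
  case: ifP => _; last by rewrite mule0.
  by rewrite -!EFinB -EFinM; congr _%:E; field; rewrite gt_eqF.
rewrite (eq_measure_integral (mscale (NngNum (ltW a0))
  (pushforward mu phi))); last first.
  by move=> A mA _; exact: scale.
by rewrite ge0_integral_mscale//= ge0_integral_pushforward.
Qed.

Lemma integral_expR_abs c : 0 < c ->
  (\int[mu]_x (expR (- c * `|x|))%:E = (2 / c)%:E)%E.
Proof.
move=> c0.
have cabs : continuous (fun x : R => expR (- c * `|x|)).
  move=> x; apply: continuous_comp; last exact: continuous_expR.
  by apply: cvgM; [exact: cvg_cst|exact: norm_continuous].
rewrite ge0_symfun_integralT//; last by move=> x /=; rewrite normrN.
rewrite -set_itvcy (_ : (2 / c)%:E = 2%:E * (0 - (- c^-1))%:E)%E; last first.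
  by rewrite sub0r opprK.
congr (_ * _)%E.
have dF (x : R) : is_derive x 1 (fun x : R => - c^-1 * expR (- c * x)) (expR (- c * x)).
  apply: is_derive_eq; rewrite /GRing.scale/=.
  by field; rewrite gt_eqF.
have cF : continuous (fun x : R => - c^-1 * expR (- c * x)).
  by move=> x; apply/differentiable_continuous/derivable1_diffP; case: (dF x).
transitivity (\int[mu]_(x in `[0%R, +oo[) (expR (- c * x)%R)%:E)%E.
  apply: eq_integral => x; rewrite inE/= in_itv/= andbT => x0.
  by rewrite ger0_norm.
rewrite (@ge0_continuous_FTC2y _ _ (fun x => - c^-1 * expR (- c * x)) 0 0).
- by rewrite mulr0 expR0 mulr1 EFinB.
- by move=> x _; exact: expR_ge0.
- apply: continuous_subspaceT => x.
  apply: continuous_comp; last exact: continuous_expR.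
  by apply: cvgM; [exact: cvg_cst|exact: cvg_id].
- rewrite -[X in _ --> X](mulr0 (- c^-1)); apply: cvgM; first exact: cvg_cst.
  rewrite (_ : (fun x => expR (- c * x)) = (fun x => expR (- x)) \o *%R c); last first.
    by apply/funext => x /=; rewrite mulNr.
  by apply: cvg_comp (@cvgr_expR R); apply: gt0_cvgMry => //; exact: cvg_id.
- by move=> x _; case: (dF x).
- by apply: cvg_at_right_filter; exact: cF.
- by move=> x _; rewrite derive1E; exact: derive_val.
Unshelve. all: by end_near. Qed.

Lemma cvg_div_sqrt_sqrD (A : R) : 0 < A ->
  x / Num.sqrt (A + x ^+ 2) @[x --> +oo] --> (1 : R).
Proof.
move=> A0.
apply: (@squeeze_cvgr _ _ _ _ (fun x => 1 - A * x^-1) (cst 1)).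
- near=> x.
  have x1 : 1 <= x by near: x; exact: nbhs_pinfty_ge.
  have x0 : 0 < x by apply: lt_le_trans x1.
  have q0 : 0 < A + x ^+ 2 by rewrite addr_gt0// exprn_gt0.
  have s0 : 0 < Num.sqrt (A + x ^+ 2) by rewrite sqrtr_gt0.
  have sE : Num.sqrt (A + x ^+ 2) ^+ 2 = A + x ^+ 2 by rewrite sqr_sqrtr// ltW.
  set s := Num.sqrt _ in s0 sE *.
  have xs : x <= s by rewrite leNgt; apply/negP => sx; nra.
  rewrite ler_pdivlMr// ler_pdivrMr// mul1r xs andbT.
  rewrite -(ler_pM2l x0) mulrA mulrBr mulr1 mulrCA divff ?gt_eqF// mulr1.
  nra.
- rewrite -[X in _ --> X]subr0; apply: cvgB; first exact: cvg_cst.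
  rewrite -[X in _ --> X](mulr0 A); apply: cvgM; first exact: cvg_cst.
  by apply/gtr0_cvgV0; [exact: nbhs_pinfty_gt|exact: cvg_id].
- exact: cvg_cst.
Unshelve. all: by end_near. Qed.

(** An antiderivative is A^-1 x / sqrt (A + x^2). *)
Lemma integral_inv_pow32 (A : R) : 0 < A ->
  (\int[mu]_x ((A + x ^+ 2) * Num.sqrt (A + x ^+ 2))^-1%:E = (2 / A)%:E)%E.
Proof.
move=> A0.
have q0 (x : R) : 0 < A + x ^+ 2 by rewrite ltr_wpDr// sqr_ge0.
have s0 (x : R) : 0 < Num.sqrt (A + x ^+ 2) by rewrite sqrtr_gt0.
have cq : continuous (fun x : R => A + x ^+ 2).
  by move=> x; apply: cvgD; [exact: cvg_cst|exact: exprn_continuous].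
have cs : continuous (fun x : R => Num.sqrt (A + x ^+ 2)).
  by move=> x; apply: continuous_comp; [exact: cq|exact: sqrt_continuous].
have cf : continuous (fun x : R => ((A + x ^+ 2) * Num.sqrt (A + x ^+ 2))^-1).
  move=> x; apply: cvgV; first by rewrite mulf_neq0// gt_eqF.
  by apply: cvgM; [exact: cq|exact: cs].
rewrite ge0_symfun_integralT//.
- rewrite -set_itvcy (_ : (2 / A)%:E = 2%:E * (A^-1)%:E)%E//; congr (_ * _)%E.
  have dF (x : R) : is_derive x 1 (fun x : R => A^-1 * (x / Num.sqrt (A + x ^+ 2)))
      ((A + x ^+ 2) * Num.sqrt (A + x ^+ 2))^-1.
    have dq : is_derive x 1 (fun x : R => A + x ^+ 2) (2 * x).
      apply: is_derive_eq; rewrite /GRing.scale/=; ring.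
    have ds : is_derive x 1 (fun x : R => Num.sqrt (A + x ^+ 2))
        ((2 * Num.sqrt (A + x ^+ 2))^-1 * (2 * x)).
      exact: (@is_derive1_comp _ (@Num.sqrt R) (fun x => A + x ^+ 2) x _ _
        (is_derive1_sqrt (q0 x)) dq).
    have dv : is_derive x 1 (fun x : R => (Num.sqrt (A + x ^+ 2))^-1)
        (- (Num.sqrt (A + x ^+ 2)) ^- 2 *: ((2 * Num.sqrt (A + x ^+ 2))^-1 * (2 * x))).
      by apply: is_deriveV => //; rewrite gt_eqF.
    apply: is_derive_eq; rewrite /GRing.scale/=.
    have sE : Num.sqrt (A + x ^+ 2) ^+ 2 = A + x ^+ 2 by rewrite sqr_sqrtr// ltW.
    have := s0 x; move: sE; set s := Num.sqrt _ => sE s0x.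
    rewrite -sE; have xE : x ^+ 2 = s ^+ 2 - A by rewrite sE; ring.
    transitivity (A^-1 * (s^-1 - x ^+ 2 / s ^+ 3)); first by field; rewrite !gt_eqF.
    by rewrite xE; field; rewrite !gt_eqF.
  have cF : continuous (fun x : R => A^-1 * (x / Num.sqrt (A + x ^+ 2))).
    by move=> x; apply/differentiable_continuous/derivable1_diffP; case: (dF x).
  rewrite (@ge0_continuous_FTC2y _ _ (fun x => A^-1 * (x / Num.sqrt (A + x ^+ 2))) 0 A^-1).
  + by rewrite mul0r mulr0 sube0.
  + by move=> x _; rewrite invr_ge0 mulr_ge0// ltW.
  + exact: continuous_subspaceT.
  + rewrite -[X in _ --> X]mulr1; apply: cvgM; first exact: cvg_cst.
    exact: cvg_div_sqrt_sqrD.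
  + by move=> x _; case: (dF x).
  + by apply: cvg_at_right_filter; exact: cF.
  + by move=> x _; rewrite derive1E; exact: derive_val.
- by move=> x; rewrite invr_ge0 mulr_ge0 ?ltW.
- by move=> x /=; rewrite sqrrN.
Qed.

End line_integrals.

(** * Iterated integrals in the plane and in space *)

Section plane.
Context {R : realType}.
Local Notation mu := (@lebesgue_measure R).
Local Notation R2 := (measurableTypeR R * measurableTypeR R)%type.

(** Naming the planar measure, and recording that it is sigma-finite, presents
    [leb3] as the product of two sigma-finite measures, the form in which the
    theorems on iterated integrals apply. *)
Definition leb2 : set R2 -> \bar R := (mu \x mu)%E.
HB.instance Definition _ := Measure.on leb2.

Let sigma_finite_leb2 : sigma_finite setT leb2.
Proof.
exists (fun n => `[- n%:R, n%:R]%classic `*` `[- n%:R, n%:R]%classic) => [|n].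
  apply/seteqP; split=> // x _.
  exists (Num.truncn (Num.max `|x.1| `|x.2|)).+1 => //=.
  have := ltW (truncnS_gt (Num.max `|x.1| `|x.2|)).
  by rewrite ge_max !in_itv/= -!ler_norml => /andP[].
split; first exact: measurableX.
rewrite /leb2 product_measure1E//= lebesgue_measure_itv/=.
by case: ifP => _; rewrite ?mul0e// -EFinB -!EFinM ltry.
Qed.

HB.instance Definition _ :=
  Measure_isSigmaFinite.Build _ _ _ leb2 sigma_finite_leb2.

Lemma leb3_tonelli (f : R3 R -> \bar R) : measurable_fun setT f ->
  (forall x, 0 <= f x)%E ->
  (\int[leb3]_x f x = \int[mu]_z \int[leb2]_p f (p, z))%E.
Proof. by move=> mf f0; exact: (@fubini_tonelli2 _ _ _ _ _ leb2 mu f mf f0). Qed.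

Lemma leb2_tonelli (f : R2 -> \bar R) : measurable_fun setT f ->
  (forall x, 0 <= f x)%E ->
  (\int[leb2]_p f p = \int[mu]_y \int[mu]_x f (x, y))%E.
Proof. by move=> mf f0; exact: (@fubini_tonelli2 _ _ _ _ _ mu mu f mf f0). Qed.

Lemma leb3_fubini12 (f : R3 R -> \bar R) : leb3.-integrable setT f ->
  (\int[leb3]_x f x = \int[leb2]_p \int[mu]_z f (p, z))%E.
Proof. by move=> fi; rewrite -(@integral12_prod_meas1 _ _ _ _ _ leb2 mu f fi). Qed.

Lemma leb3_fubini21 (f : R3 R -> \bar R) : leb3.-integrable setT f ->
  (\int[leb3]_x f x = \int[mu]_z \int[leb2]_p f (p, z))%E.
Proof. by move=> fi; rewrite -(@integral21_prod_meas1 _ _ _ _ _ leb2 mu f fi). Qed.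

Lemma leb3_ae_integrable (f : R3 R -> \bar R) : leb3.-integrable setT f ->
  {ae mu, forall z, leb2.-integrable setT (fun p => f (p, z))}.
Proof. by move=> fi; exact: (@ae_integrable2 _ _ _ _ _ leb2 mu f fi). Qed.

Lemma leb3_measurable_fubini (f : R3 R -> \bar R) : leb3.-integrable setT f ->
  measurable_fun setT (fun z => \int[leb2]_p f (p, z))%E.
Proof. by move=> fi; exact: (@measurable_fubini_G _ _ _ _ _ leb2 mu f fi). Qed.

Lemma leb2_fubini12 (f : R2 -> \bar R) : leb2.-integrable setT f ->
  (\int[leb2]_p f p = \int[mu]_x \int[mu]_y f (x, y))%E.
Proof. by move=> fi; rewrite -(@integral12_prod_meas1 _ _ _ _ _ mu mu f fi). Qed.

Lemma leb2_fubini21 (f : R2 -> \bar R) : leb2.-integrable setT f ->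
  (\int[leb2]_p f p = \int[mu]_y \int[mu]_x f (x, y))%E.
Proof. by move=> fi; rewrite -(@integral21_prod_meas1 _ _ _ _ _ mu mu f fi). Qed.

End plane.

(** * Total mass of the measure *)

Section mass.
Context {R : realType}.
Local Notation mu := (@lebesgue_measure R).
Local Notation R1 := (measurableTypeR R).
Local Notation R2 := (measurableTypeR R * measurableTypeR R)%type.

Lemma plane_scale (f : R2 -> \bar R) (a : R) : 0 < a ->
  measurable_fun setT f -> (forall p, 0 <= f p)%E ->
  (\int[leb2]_p f p =
   (a ^+ 2)%:E * \int[leb2]_p f (a * p.1, a * p.2)%R)%E.
Proof.
move=> a0 mf f0.
have ma : measurable_fun setT (fun x : R1 => a * x : R1) by exact: measurable_funM.
pose f' (p : R2) := f ((a * p.1)%R, p.2).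
have mf' : measurable_fun setT f'.
  apply: measurableT_comp mf _; apply: measurable_fun_pair => //.
  exact: measurableT_comp ma _.
pose f'' (p : R2) := f ((a * p.1)%R, (a * p.2)%R).
have mf'' : measurable_fun setT f''.
  apply: measurableT_comp mf _; apply: measurable_fun_pair.
    exact: measurableT_comp ma _.
  exact: measurableT_comp ma _.
rewrite leb2_tonelli// -/f''.
rewrite [X in _ = (_ * X)%E](_ : _ = \int[leb2]_p f'' p)%E//.
rewrite (leb2_tonelli mf'')//; last by move=> p; exact: f0.
have mG := @measurable_fun_fubini_tonelli_G _ _ _ _ _ mu f' mf' (fun p => f0 _).
have mG' := @measurable_fun_fubini_tonelli_G _ _ _ _ _ mu f'' mf'' (fun p => f0 _).
rewrite /fubini_G in mG mG' *.
rewrite (eq_integral (fun y => a%:E * \int[mu]_x f' (x, y))%E); last first.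
  move=> y _; rewrite [LHS](ge0_integral_scale a0)//.
  by apply: measurableT_comp mf _; exact: measurable_fun_pair.
rewrite ge0_integralZl//; last 2 first.
- by move=> y _; apply: integral_ge0 => x _; exact: f0.
- by rewrite lee_fin ltW.
rewrite [X in (_ * X)%E = _](ge0_integral_scale a0)//; last by move=> y; apply: integral_ge0 => x _; exact: f0.
by rewrite muleA -EFinM.
Qed.

(** The planar counterpart of [oneDsqr]: the squared length of (s, t, 1). *)
Definition oneDsqr2 (p : R2) : R := 1 + p.1 ^+ 2 + p.2 ^+ 2.

Local Notation Q := oneDsqr2.

Let Q_gt0 p : 0 < Q p. Proof. by rewrite /oneDsqr2 !ltr_wpDr ?sqr_ge0. Qed.

Let measurable_Q : measurable_fun setT Q.
Proof.
apply: measurable_funD; last by apply: measurable_funX; exact: measurable_snd.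
by apply: measurable_funD => //; apply: measurable_funX; exact: measurable_fst.
Qed.

Let measurable_sqrt : measurable_fun setT (@Num.sqrt R).
Proof. by apply: continuous_measurable_fun; exact: sqrt_continuous. Qed.

Let measurable_Q32 : measurable_fun setT (fun p => (Q p * Num.sqrt (Q p))^-1).
Proof.
rewrite (_ : (fun _ => _) = (fun p => (Q p * Num.sqrt (Q p)) `^ (-1))).
  apply: measurableT_comp (measurable_powR _) _; apply: measurable_funM => //.
  exact: measurableT_comp.
by apply/funext => p; rewrite powR_inv1// mulr_ge0// ?sqrtr_ge0// ltW.
Qed.

(** Integrating over one variable with A = 1 + y^2 leaves 2 / (1 + y^2), whose
    integral is 2 pi. *)
Lemma plane_integral_pow32 :
  (\int[leb2]_p ((Q p * Num.sqrt (Q p))^-1)%:E = (2 * pi)%:E)%E.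
Proof.
rewrite leb2_tonelli//=; last 2 first.
- exact/measurable_EFinP.
- by move=> p; rewrite lee_fin invr_ge0 mulr_ge0 ?sqrtr_ge0// ltW.
rewrite (eq_integral (fun y : R1 => 2%:E * (oneDsqr y)^-1%:E))%E; last first.
  move=> y _; rewrite -EFinM -integral_inv_pow32 ?oneDsqr_gt0//.
  by apply: eq_integral => x _; rewrite /oneDsqr /oneDsqr2/= addrAC.
rewrite ge0_integralZl//; last first.
  apply/measurable_EFinP; apply: continuous_measurable_fun.
  exact: continuous_oneDsqrV.
rewrite ge0_symfun_integralT//; last 2 first.
- exact: continuous_oneDsqrV.
- by move=> x /=; rewrite /oneDsqr sqrrN.
rewrite -set_itvcy integral0y_oneDsqr -!EFinM; congr _%:E; lra.
Qed.

Lemma psi_sqrE (gamma : R) (x : R3 R) : 0 < gamma ->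
  psi gamma x ^+ 2 = gamma / (2 * pi) *
    (expR (- (2 * gamma) * enorm x) / enorm x ^+ 2).
Proof.
move=> g0; have pi0 : 0 <= 2 * pi :> R by rewrite mulr_ge0 ?pi_ge0.
rewrite /psi !exprMn !exprVn (sqr_sqrtr (ltW g0)) (sqr_sqrtr pi0).
by rewrite -expRM_natl; congr (_ * (expR _ / _)); ring.
Qed.

(** Scaling the plane at height z by |z| turns |x| into |z| sqrt (1 + s^2 + t^2)
    and absorbs the factor 1 / |x|^2 up to 1 / (1 + s^2 + t^2). Exchanging the
    integrals and integrating over z first leaves the integral of
    (1 + s^2 + t^2)^(-3/2) over the plane. *)
Theorem psi_measure_setT (gamma : R) : 0 < gamma ->
  psi_measure gamma setT = 1%E.
Proof.
move=> g0; rewrite /psi_measure.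
pose c := 2 * gamma; have c0 : 0 < c by rewrite mulr_gt0.
pose k (x : R3 R) : \bar R := (expR (- c * enorm x) / enorm x ^+ 2)%:E.
have kpsi x : ((psi gamma x ^+ 2)%:E = (gamma / (2 * pi))%:E * k x)%E.
  by rewrite psi_sqrE.
have gpi : 0 < gamma / (2 * pi) by rewrite divr_gt0// mulr_gt0// pi_gt0.
have mk : measurable_fun setT k.
  apply/measurable_EFinP.
  rewrite (_ : (fun _ => _) = (fun x => (gamma / (2 * pi))^-1 * psi gamma x ^+ 2)).
    by apply: measurable_funM => //; apply: measurable_funX; exact: measurable_psi.
  by apply/funext => x; rewrite psi_sqrE// mulKf// gt_eqF.
have k0 x : (0 <= k x)%E by rewrite lee_fin divr_ge0 ?expR_ge0// sqr_ge0.
under eq_integral do rewrite kpsi.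
rewrite ge0_integralZl//; last by rewrite lee_fin ltW.
suff -> : (\int[leb3]_x k x = (2 * pi / gamma)%:E)%E.
  rewrite -EFinM; congr _%:E; move: (pi_gt0 R); generalize (pi : R) => p p0.
  by field; rewrite (gt_eqF g0) (gt_eqF p0).
rewrite leb3_tonelli//.
pose H (zp : R1 * R2) : \bar R :=
  (expR (- (c * Num.sqrt (Q zp.2)) * `|zp.1|) * (Q zp.2)^-1)%:E.
have mQV : measurable_fun setT (fun p => (Q p)^-1).
  rewrite (_ : (fun _ => _) = (fun p => Q p `^ (-1))).
    exact: measurableT_comp (measurable_powR _) measurable_Q.
  by apply/funext => p; rewrite powR_inv1// ltW.
have mH : measurable_fun setT H.
  apply/measurable_EFinP/measurable_funM.
    apply: measurableT_comp; first exact: measurable_expR.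
    apply: measurable_funM.
      apply: measurableT_comp => //; apply: measurable_funM => //.
      apply: (measurableT_comp measurable_sqrt).
      exact: measurableT_comp measurable_Q measurable_snd.
    apply: measurableT_comp => //; exact: measurable_fst.
  exact: measurableT_comp mQV measurable_snd.
have H0 zp : (0 <= H zp)%E by rewrite lee_fin mulr_ge0 ?expR_ge0 ?invr_ge0// ltW.
transitivity (\int[mu]_z \int[leb2]_p H (z, p))%E.
  apply: ge0_ae_eq_integral => //.
  - exact: (@measurable_fun_fubini_tonelli_G _ _ _ _ _ leb2 k mk k0).
  - exact: (@measurable_fun_fubini_tonelli_F _ _ _ _ _ leb2 H mH H0).
  - by move=> z _; apply: integral_ge0 => p _.
  - by move=> z _; apply: integral_ge0 => p _.
  exists [set 0]; split => //; first exact: lebesgue_measure_set1.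
  move=> z /=; apply: contra_notP => /eqP z0 _.
  have az0 : 0 < `|z| by rewrite normr_gt0.
  rewrite (plane_scale az0)//; last exact: measurableT_comp mk (measurable_pair2 _).
  rewrite -ge0_integralZl//; last first.
    apply: (measurableT_comp mk); apply: measurable_fun_pair => //.
    have ma : measurable_fun setT (fun x : R1 => `|z| * x : R1).
      exact: measurable_funM.
    by apply: measurable_fun_pair; exact: measurableT_comp ma _.
  apply: eq_integral => p _; rewrite /k /H -EFinM; congr _%:E.
  have -> : enorm (`|z| * p.1, `|z| * p.2, z) = `|z| * Num.sqrt (Q p).
    rewrite /enorm/= -[X in _ = X * _]sqrtr_sqr -sqrtrM ?sqr_ge0//.
    congr Num.sqrt; rewrite /oneDsqr2 !exprMn !real_normK ?num_real//; ring.
  rewrite exprMn sqr_sqrtr ?ltW// mulrCA; congr (expR _ * _); first by ring.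
  by field; rewrite gt_eqF//= gt_eqF.
rewrite (@fubini_tonelli _ _ _ _ _ mu leb2 H mH H0).
rewrite (eq_integral (fun p => gamma^-1%:E * ((Q p * Num.sqrt (Q p))^-1)%:E))%E; last first.
  move=> p _; rewrite /H/=.
  have s0 : 0 < Num.sqrt (Q p) by rewrite sqrtr_gt0.
  under eq_integral do rewrite EFinM.
  rewrite ge0_integralZr//; last 2 first.
  - apply/measurable_EFinP/measurableT_comp; first exact: measurable_expR.
    by apply: measurable_funM => //; exact: measurableT_comp.
  - by rewrite lee_fin invr_ge0 ltW.
  rewrite integral_expR_abs ?mulr_gt0// -!EFinM; congr _%:E.
  rewrite /c; field; by rewrite (gt_eqF g0) (gt_eqF s0) (gt_eqF (Q_gt0 p)).
rewrite ge0_integralZl//; last 3 first.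
- exact/measurable_EFinP.
- by move=> p _; rewrite lee_fin invr_ge0 mulr_ge0 ?sqrtr_ge0// ltW.
- by rewrite lee_fin invr_ge0 ltW.
rewrite plane_integral_pow32 -EFinM; congr _%:E; ring.
Qed.

End mass.

(** * Smooth functions of one variable *)

Section smooth.
Context {R : realType}.
Implicit Types (f g : R -> R) (n k : nat) (a b c x y : R).

Fixpoint Cn1 n f : Prop :=
  if n is n'.+1 then (forall x, derivable f x 1) /\ Cn1 n' (derive1 f)
  else continuous f.

Lemma derivable_continuous f : (forall x, derivable f x 1) -> continuous f.
Proof. by move=> df x; apply/differentiable_continuous/derivable1_diffP. Qed.

Lemma Cn1S n f : Cn1 n.+1 f -> Cn1 n f.
Proof.
elim: n f => [|n IH] f [df f'].
  exact: derivable_continuous.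
by split => //; exact: IH.
Qed.

Lemma Cn1D n f g : Cn1 n f -> Cn1 n g -> Cn1 n (fun x => f x + g x).
Proof.
elim: n f g => [|n IH] f g.
  by move=> cf cg x; apply: cvgD; [exact: cf|exact: cg].
move=> [df f'] [dg g']; split; first by move=> x; exact: derivableD.
rewrite (_ : derive1 _ = (fun x => (derive1 f) x + (derive1 g) x)); first exact: IH.
by apply/funext => x; rewrite !derive1E deriveD.
Qed.

Lemma Cn1M n f g : Cn1 n f -> Cn1 n g -> Cn1 n (fun x => f x * g x).
Proof.
elim: n f g => [|n IH] f g.
  by move=> cf cg x; apply: cvgM; [exact: cf|exact: cg].
move=> sf sg; have [df f'] := sf; have [dg g'] := sg.
split; first by move=> x; exact: derivableM.
rewrite (_ : derive1 _ = (fun x => f x * (derive1 g) x + g x * (derive1 f) x)).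
  by apply: Cn1D; apply: IH => //; exact: Cn1S.
by apply/funext => x; rewrite !derive1E deriveM.
Qed.

Lemma Cn1_cst n c : Cn1 n (cst c).
Proof.
elim: n c => [|n IH] c; first by move=> x; exact: cvg_cst.
split; first by move=> x; exact: derivable_cst.
rewrite (_ : derive1 _ = cst 0) //.
by apply/funext => x; rewrite derive1E derive_cst.
Qed.

Lemma Cn1_affine n f a b : Cn1 n f -> Cn1 n (fun x => f (a * x + b)).
Proof.
have daff x : is_derive x 1 (fun y : R => a * y + b) a.
  by apply: is_derive_eq; rewrite /GRing.scale/=; ring.
have caff : continuous (fun y : R => a * y + b).
  by apply: derivable_continuous => x; case: (daff x).
elim: n f => [|n IH] f.
  by move=> cf x; apply: continuous_comp; [exact: caff|exact: cf].
move=> [df f'].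
have dfa x : is_derive x 1 (fun y => f (a * y + b)) ((derive1 f) (a * x + b) * a).
  apply: (@is_derive1_comp _ f (fun y => a * y + b)).
  by rewrite derive1E; exact: derivableP.
split; first by move=> x; case: (dfa x).
rewrite (_ : derive1 _ = (fun x => (derive1 f) (a * x + b) * cst a x)).
  by apply: Cn1M; [exact: IH|exact: Cn1_cst].
by apply/funext => x; rewrite derive1E; have [_ ->] := dfa x.
Qed.

Definition smooth f := forall n, Cn1 n f.

Lemma smooth_derivable f x : smooth f -> derivable f x 1.
Proof. by move=> /(_ 1)[]. Qed.

Lemma smooth_continuous f : smooth f -> continuous f.
Proof. by move=> /(_ 0). Qed.

Lemma smooth_derive1 f : smooth f -> smooth (derive1 f).
Proof. by move=> sf n; case: (sf n.+1). Qed.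

(** The functions y^-k exp (- c / y), extended by 0 to the left: their family is
    stable under derivation up to linear combinations, so that an induction on
    the order of differentiability proves smoothness for all k at once. *)
Definition flat k c y := if 0 < y then y^-1 ^+ k * expR (- (c / y)) else 0.

(** The exponential exp (c / y) dominates the term of degree k + 1 of its
    series. *)
Lemma flat_le k c y : 0 < c -> 0 < y ->
  flat k c y <= k.+1`!%:R / c ^+ k.+1 * y.
Proof.
move=> c0 y0; rewrite /flat y0 expRN.
have cy0 : 0 < c / y by rewrite divr_gt0.
have := expR_ge1Dxn k (ltW cy0).
have f0 : 0 < k.+1`!%:R :> R by rewrite ltr0n fact_gt0.
have e0 := expR_gt0 (c / y).
set E := expR _ in e0 *; set F : R := k.+1`!%:R in f0 * => h.
have {}h : (c / y) ^+ k.+1 / F <= E by lra.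
rewrite ler_pdivrMr//; apply: (@le_trans _ _ (F / c ^+ k.+1 * y * ((c / y) ^+ k.+1 / F))).
  rewrite le_eqVlt; apply/orP; left; apply/eqP.
  rewrite expr_div_n [y ^+ k.+1]exprS exprVn; field.
  by rewrite !expf_neq0 ?gt_eqF.
by rewrite ler_wpM2l// !mulr_ge0 ?invr_ge0 ?exprn_ge0 ?ltW.
Qed.

Lemma flat_ge0 k c y : 0 <= flat k c y.
Proof.
rewrite /flat; case: ifP => // y0.
by rewrite mulr_ge0 ?expR_ge0// exprn_ge0// invr_ge0 ltW.
Qed.

(** Away from 0 this is the usual computation; at 0 the difference quotient is
    [flat k.+1 c], which is O(y) by [flat_le]. *)
Lemma is_derive_flat k c y : 0 < c ->
  is_derive y 1 (flat k c) (c * flat k.+2 c y - k%:R * flat k.+1 c y).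
Proof.
move=> c0; have [y0|y0|<-] := ltgtP 0 y.
- have dv : is_derive y 1 (fun y : R => y^-1) (- y ^- 2 *: 1).
    by apply: is_deriveV; rewrite gt_eqF.
  have de : is_derive y 1 (fun y : R => expR (- (c / y))) (expR (- (c / y)) * (c / y ^+ 2)).
    apply: (@is_derive1_comp _ (@expR R) (fun y => - (c / y))).
    apply: is_derive_eq; rewrite /GRing.scale/=; field.
    by rewrite gt_eqF.
  have : is_derive y 1 (fun y => y^-1 ^+ k * expR (- (c / y)))
     (c * flat k.+2 c y - k%:R * flat k.+1 c y).
    have := is_deriveM (is_deriveX k dv) de.
    rewrite (_ : _ * _ = (fun z : R => z^-1 ^+ k * expR (- (c / z)))); last first.
      by apply/funext => z; rewrite !fctE.
    move=> dM; apply: is_derive_eq.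
    rewrite exprfctE /GRing.scale/= /flat y0. rewrite -exprVn.
    by case: (k) => [|k'] /=; rewrite ?exprS -?natr1; ring.
  apply: near_eq_is_derive => //.
  near=> z; rewrite /flat ifT//; near: z; exact: lt_nbhsr.
- have : is_derive y 1 (cst 0) (c * flat k.+2 c y - k%:R * flat k.+1 c y).
    apply: is_derive_eq; rewrite /flat ltNge (ltW y0)/=; ring.
  apply: near_eq_is_derive => //.
  near=> z; rewrite /flat ifN// -leNgt ltW//; near: z; exact: lt_nbhsl.
rewrite [X in is_derive _ _ _ X](_ : _ = 0); last by rewrite /flat ltxx; ring.
have d0 : h^-1 *: (flat k c (h + 0) - flat k c 0) @[h --> 0^'] --> (0 : R).
  set K : R := k.+2`!%:R / c ^+ k.+2.
  have K0 : 0 <= K by rewrite divr_ge0 ?exprn_ge0// ltW.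
  apply/cvgr0Pnorm_le => e e0; near=> h.
  have hn0 : h != 0 by near: h; exact: nbhs_dnbhs_neq.
  have he : `|h| <= e / (K + 1).
    near: h; apply: nbhs_dnbhs; apply: (@nbhs0_le _ R) => //.
    by rewrite divr_gt0// ltr_wpDl.
  apply: (@le_trans _ _ (K * `|h|)).
    rewrite /flat ltxx subr0 addr0; case: ifP => h0.
      have := flat_le k.+1 c0 h0; rewrite {1}/flat h0 -/K exprS -mulrA.
      rewrite (gtr0_norm h0) ger0_norm//.
      by rewrite /GRing.scale/= !mulr_ge0 ?expR_ge0 ?exprn_ge0// invr_ge0 ltW.
    by rewrite scaler0 normr0 mulr_ge0.
  move: he; rewrite ler_pdivlMr ?ltr_wpDl// => he.
  apply: le_trans he; rewrite mulrC ler_wpM2l// lerDl//.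
split; last by apply/cvg_lim => //; move: d0; under eq_fun do rewrite -[X in X + 0](@mulr1 R).
by apply/cvg_ex; exists 0; move: d0; under eq_fun do rewrite -[X in X + 0](@mulr1 R).
Unshelve. all: by end_near. Qed.

Lemma smooth_flat k c : 0 < c -> smooth (flat k c).
Proof.
move=> c0 n; elim: n k => [|n IH] k.
  by apply: derivable_continuous => x; case: (is_derive_flat k x c0).
split=> [x|]; first by case: (is_derive_flat k x c0).
rewrite (_ : derive1 _ =
    fun y => cst c y * flat k.+2 c y + cst (- k%:R) y * flat k.+1 c y).
  by apply: Cn1D; apply: Cn1M => //; exact: Cn1_cst.
apply/funext => y; rewrite derive1E; have [_ ->] := is_derive_flat k y c0.
by rewrite /= mulNr.
Qed.

(** Supported in [a, b]; when c tends to 0 the bump tends to 1 inside. *)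
Definition bump a b c x := flat 0 c (x - a) * flat 0 c (b - x).

Lemma smooth_bump a b c : 0 < c -> smooth (bump a b c).
Proof.
move=> c0 n; apply: Cn1M.
  rewrite (_ : (fun _ => _) = fun x => flat 0 c (1 * x + - a)).
    by apply: Cn1_affine; exact: smooth_flat.
  by apply/funext => x; rewrite mul1r.
rewrite (_ : (fun _ => _) = fun x => flat 0 c (-1 * x + b)).
  by apply: Cn1_affine; exact: smooth_flat.
by apply/funext => x; rewrite mulN1r addrC.
Qed.

Lemma flat0_le1 c y : 0 < c -> flat 0 c y <= 1.
Proof.
move=> c0; rewrite /flat; case: ifP => [y0|]; last by rewrite ler01.
by rewrite expr0 mul1r -expR0 ler_expR oppr_le0 divr_ge0// ltW.
Qed.

Lemma bump_ge0 a b c x : 0 <= bump a b c x.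
Proof. by rewrite mulr_ge0 ?flat_ge0. Qed.

Lemma bump_le1 a b c x : 0 < c -> bump a b c x <= 1.
Proof. by move=> c0; rewrite mulr_ile1 ?flat_ge0 ?flat0_le1. Qed.

Lemma bumpE a b c x : a < x -> x < b ->
  bump a b c x = expR (- (c / (x - a))) * expR (- (c / (b - x))).
Proof. by move=> ax xb; rewrite /bump /flat !subr_gt0 ax xb !expr0 !mul1r. Qed.

Lemma bump_out a b c x : (x <= a) || (b <= x) -> bump a b c x = 0.
Proof.
by rewrite /bump /flat !subr_gt0 !ltNge => /orP[->|->]; rewrite ?mul0r ?mulr0.
Qed.

Definition test1 f := smooth f /\ exists M, forall x, M <= `|x| -> f x = 0.

Lemma test1_bump a b c : 0 < c -> test1 (bump a b c).
Proof.
move=> c0; split; first exact: smooth_bump.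
exists (Num.max `|a| `|b|) => x; rewrite ge_max => /andP[ax bx]; apply: bump_out.
have [x0|x0] := leP 0 x.
  by rewrite (le_trans (ler_norm b))// ?orbT// (le_trans bx) ?ger0_norm.
rewrite -lerN2 -(ltr0_norm x0) (le_trans _ ax)//.
by rewrite -normrN ler_norm.
Qed.

Lemma test1_out f M : (forall x, M <= `|x| -> f x = 0) ->
  f = f \_ `[- `|M|, `|M|]%classic.
Proof.
move=> fM; apply/funext => x; rewrite patchE; case: ifPn => // xM.
apply: fM; apply/ltW; apply: (le_lt_trans (ler_norm M)); rewrite ltNge.
by apply: contra xM; rewrite inE/= in_itv/= ler_norml.
Qed.

Lemma test1_integrable f : test1 f ->
  (@lebesgue_measure R).-integrable setT (EFin \o f).
Proof.
move=> [sf [M fM]]; rewrite (test1_out fM) -restrict_EFin.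
apply/integrable_restrict => //=; rewrite setTI.
apply: continuous_compact_integrable; first exact: segment_compact.
by apply: continuous_subspaceT; exact: smooth_continuous.
Qed.

Lemma test1D f g : test1 f -> test1 g -> test1 (fun x => f x + g x).
Proof.
move=> [sf [M fM]] [sg [N gN]]; split; first by move=> n; exact: Cn1D.
exists (Num.max M N) => x; rewrite ge_max => /andP[Mx Nx].
by rewrite fM// gN// addr0.
Qed.

Lemma test1Z c f : test1 f -> test1 (fun x => c * f x).
Proof.
move=> [sf [M fM]]; split.
  by move=> n; apply: (@Cn1M n (cst c)) => //; exact: Cn1_cst.
by exists M => x Mx; rewrite fM// mulr0.
Qed.

(** The primitive from minus infinity vanishes to the left of the support, and
    to the right of it too because the total integral is zero. *)
Lemma test1_primitive f : test1 f -> \int[lebesgue_measure]_x f x = 0 ->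
  exists2 F, test1 F & derive1 F = f.
Proof.
move=> tf int0; have fi := test1_integrable tf; have [sf [M fM]] := tf.
pose F x := \int[lebesgue_measure]_(t in `]-oo, x]) f t.
have dF x : derivable F x 1 /\ derive1 F x = f x.
  apply: (@continuous_FTC1 _ f -oo%O x (x + 1)) => //.
  - by rewrite ltrDl.
  - by apply: integrableS fi.
  - by rewrite ltNyr.
  - exact: smooth_continuous.
have F'f : derive1 F = f by apply/funext => x; case: (dF x).
exists F => //; split.
  case=> [|n]; first by apply: derivable_continuous => x; case: (dF x).
  by split; [move=> x; case: (dF x)|rewrite F'f].
exists `|M| => x Mx.
have [x0|x0] := leP 0 x.
  rewrite -int0 /F Rintegral_mkcond; apply: eq_Rintegral => y _.
  rewrite patchE; case: ifPn => // xy; rewrite fM//.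
  have {}xy : x < y by rewrite ltNge; apply: contra xy => yx; rewrite inE/= in_itv.
  rewrite (le_trans (ler_norm M))// (le_trans Mx)// ger0_norm//.
  by rewrite (le_trans (ltW xy))// ler_norm.
rewrite /F; under eq_Rintegral.
  move=> y; rewrite inE/= in_itv/= => yx.
  rewrite fM; first over.
  rewrite (le_trans (ler_norm M))// (le_trans Mx)// ltr0_norm//.
  rewrite ltr0_norm ?lerN2//; exact: le_lt_trans x0.
by rewrite Rintegral_cst// mul0r.
Qed.

End smooth.

(** * Topology and measurability of the space *)

Section space.
Context {R : realType}.
Implicit Types (x y p : R3 R) (M : R).

Lemma norm_R3 x : `|x| = Num.max (Num.max `|x.1.1| `|x.1.2|) `|x.2|.
Proof. by []. Qed.

Lemma norm_R3_le x M : (`|x| <= M) = [&& `|x.1.1| <= M, `|x.1.2| <= M & `|x.2| <= M].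
Proof. by rewrite norm_R3 !ge_max andbA. Qed.

Lemma norm_R3_lt x M : (`|x| < M) = [&& `|x.1.1| < M, `|x.1.2| < M & `|x.2| < M].
Proof. by rewrite norm_R3 !gt_max andbA. Qed.

Lemma measurable_norm_R3 : measurable_fun setT (fun x : R3 R => `|x| : R).
Proof.
rewrite (_ : (fun _ => _) =
  (fun x : R3 R => Num.max (Num.max `|x.1.1| `|x.1.2|) `|x.2|)) //.
apply: measurable_maxr; last by apply: measurableT_comp => //; exact: measurable_snd.
apply: measurable_maxr; apply: measurableT_comp => //.
  exact: measurableT_comp measurable_fst measurable_fst.
exact: measurableT_comp measurable_snd measurable_fst.
Qed.

(** An open set is the union of the countably many balls with rational centre
    and inverse integer radius that it contains; for the maximum norm, such
    balls are measurable for the product structure. *)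
Lemma open_measurable_R3 (U : set (R3 R)) : open U -> measurable U.
Proof.
move=> oU.
pose B (qn : (rat * rat * rat) * nat) : set (R3 R) :=
  [set x | `|x - (ratr qn.1.1.1, ratr qn.1.1.2, ratr qn.1.2)| < qn.2.+1%:R^-1].
have mB qn : measurable (B qn).
  case: qn => [[[q1 q2] q3] n]; rewrite /B/=; set c := (_, _, _); set e := _^-1.
  have msub : measurable_fun setT (fun x : R3 R => x - c : R3 R).
    apply: measurable_fun_pair; last by apply: measurable_funB => //; exact: measurable_snd.
    apply: measurable_fun_pair; apply: measurable_funB => //.
      exact: measurableT_comp measurable_fst measurable_fst.
    exact: measurableT_comp measurable_snd measurable_fst.
  rewrite (_ : [set x | _] = setT `&` (fun x : R3 R => `|x - c| : R) @^-1` `]-oo, e[%classic).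
    exact: (measurableT_comp measurable_norm_R3 msub).
  by rewrite setTI; apply/seteqP; split=> x /=; rewrite in_itv.
pose F qn := if `[< B qn `<=` U >] then B qn else set0.
rewrite (_ : U = \bigcup_qn F qn).
  apply: countable_bigcupT_measurable => // qn; rewrite /F; case: asboolP => //.
apply/seteqP; split=> [x Ux|x [qn _]]; last by rewrite /F; case: asboolP => // BU; exact: BU.
have /nbhs_ballP[e /= e0 xeU] : nbhs x U by exact: open_nbhs_nbhs.
have [n ne] : exists n : nat, n.+1%:R^-1 + n.+1%:R^-1 < e :> R.
  exists (Num.truncn (2 / e)); set n := _.+1.
  have : 2 / e < n%:R by exact: truncnS_gt.
  by rewrite ltr_pdivrMr// mulrC -ltr_pdivrMr ?ltr0n// mulr2n mulrDl mul1r.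
have qx (r : R) : exists q : rat, `|r - ratr q| < n.+1%:R^-1.
  have : r - n.+1%:R^-1 < r + n.+1%:R^-1.
    by rewrite ltrD2l gtrN// invr_gt0.
  move=> /rat_in_itvoo[q]; rewrite in_itv/= => q12; exists q.
  by rewrite distrC ltr_distl.
have [q1 hq1] := qx x.1.1; have [q2 hq2] := qx x.1.2; have [q3 hq3] := qx x.2.
have xB : B ((q1, q2, q3), n) x.
  by rewrite /B /= norm_R3_lt /= hq1 hq2 hq3.
exists ((q1, q2, q3), n) => //; rewrite /F; case: asboolP => // -[].
move=> y; rewrite /B /= => yB; apply: xeU; rewrite -ball_normE /ball_ /=.
rewrite -(subrK (ratr q1, ratr q2, ratr q3) x) -addrA.
apply: le_lt_trans (ler_normD _ _) _; apply: lt_trans ne.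
by rewrite ltrD// distrC.
Qed.

Lemma continuous_measurable_R3 (f : R3 R -> R) : continuous f -> measurable_fun setT f.
Proof.
move=> cf; apply: (measurability _ (RGenOpens.measurableE R)).
move=> _ [_ [a [b ->] <-]]; rewrite setTI; apply: open_measurable_R3.
by apply: open_comp; [move=> x _; exact: cf|exact: interval_open].
Qed.

Definition cube M : set (R3 R) :=
  (`[- M, M]%classic `*` `[- M, M]%classic) `*` `[- M, M]%classic.

Lemma cubeE M x : cube M x <-> `|x| <= M.
Proof.
rewrite norm_R3_le /cube/= !in_itv/= -!ler_norml.
by split=> [[[-> ->] ->]//|/and3P[]].
Qed.

Lemma measurable_cube M : measurable (cube M).
Proof. by apply: measurableX => //; exact: measurableX. Qed.

Lemma compact_cube M : compact (cube M).
Proof.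
by apply: compact_setX; [apply: compact_setX|]; exact: segment_compact.
Qed.

Lemma leb3_cube_lty M : (leb3 (cube M) < +oo)%E.
Proof.
rewrite /leb3 /cube product_measure1E//=; last exact: measurableX.
rewrite product_measure1E//= lebesgue_measure_itv/=.
by case: ifP => _; rewrite ?mul0e// -EFinB -!EFinM ltry.
Qed.

Lemma set1_R3 x : [set x] = ([set x.1.1] `*` [set x.1.2]) `*` [set x.2].
Proof.
apply/seteqP; split=> y /=; first by move=> ->.
by case: y => [[a b] c] /= [[-> ->] ->]; case: (x) => [[]].
Qed.

Lemma measurable_set1_R3 x : measurable [set x].
Proof. by rewrite set1_R3; apply: measurableX => //; exact: measurableX. Qed.

Lemma leb3_set1 x : leb3 [set x] = 0%E.
Proof.
rewrite set1_R3 /leb3 product_measure1E//=; last exact: measurableX.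
by rewrite lebesgue_measure_set1 mule0.
Qed.

End space.

(** * Integrals of partial derivatives *)

Section test_functions.
Context {R : realType}.
Local Notation mu := (@lebesgue_measure R).
Implicit Types (x y p : R3 R) (M : R) (phi g : R3 R -> R).

Lemma continuous_supported_integrable g M : continuous g ->
  (forall x, M < `|x| -> g x = 0) -> (@leb3 R).-integrable setT (EFin \o g).
Proof.
move=> cg gM.
have -> : EFin \o g = (EFin \o g) \_ (cube M).
  apply/funext => x; rewrite patchE; case: ifPn => //= xM; rewrite gM//.
  by rewrite ltNge; apply: contra xM => xM; rewrite inE; exact/cubeE.
apply/integrable_restrict => //=; first exact: measurable_cube.
rewrite setTI; apply: measurable_bounded_integrable.
- exact: measurable_cube.
- exact: leb3_cube_lty.
- by apply: measurable_funTS; exact: continuous_measurable_R3.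
- have : compact (g @` cube M).
    apply: continuous_compact; last exact: compact_cube.
    by apply: continuous_subspaceT.
  move=> /compact_bounded[N [Nr hN]]; exists N; split => // K NK x Mx.
  by apply: (hN K NK); exists x.
Qed.

Lemma is_derive_line (f : R3 R -> R) p v (s : R) : derivable f (s *: v + p) v ->
  is_derive s 1 (fun t : R => f (t *: v + p)) ('D_v f (s *: v + p)).
Proof.
move=> df.
have E : (fun h : R => h^-1 *: (((fun t : R => f (t *: v + p)) \o shift s) (h *: 1) - f (s *: v + p)))
   = (fun h : R => h^-1 *: ((f \o shift (s *: v + p)) (h *: v) - f (s *: v + p))).
  apply/funext => h; congr (_ *: (f _ - _)).
  by rewrite /= addrA -scalerDl /GRing.scale/= mulr1.
by split; rewrite /derivable /derive E.
Qed.

Lemma test_function_support phi : test_function phi ->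
  exists M, forall x, M < `|x| -> \near x, phi x = 0.
Proof.
move=> [_ /compact_bounded[M [_ hM]]]; exists (M + 1) => x Mx.
have nx : ~ closure [set x | phi x != 0] x.
  have M1 : M < M + 1 by rewrite ltrDl.
  by move=> /(hM _ M1) /=; rewrite leNgt Mx.
have oC : open (~` closure [set x | phi x != 0]).
  by rewrite openC; exact: closed_closure.
apply: filterS (open_nbhs_nbhs (conj oC nx)) => y ny.
by apply/eqP; apply: contra_notT ny => py; exact: subset_closure.
Qed.

Lemma test_function_derivable phi i x : test_function phi -> derivable phi x (e3 i).
Proof. by move=> [/(_ 1)[]]. Qed.

Lemma partial_continuous phi i : test_function phi -> continuous (partial i phi).
Proof. by move=> [/(_ 1)[_ /(_ i)]]. Qed.

Lemma partial_support phi i : test_function phi ->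
  exists M, forall x, M < `|x| -> partial i phi x = 0 /\ phi x = 0.
Proof.
move=> /test_function_support[M hM]; exists M => x Mx; split.
  rewrite /partial (@near_eq_derive _ _ _ _ (cst 0)); last exact: hM.
  by rewrite derive_cst.
exact: nbhs_singleton (hM x Mx).
Qed.

Lemma partial_integrable phi i : test_function phi ->
  (@leb3 R).-integrable setT (EFin \o partial i phi).
Proof.
move=> tphi; have [M hM] := partial_support i tphi.
apply: (@continuous_supported_integrable _ M); first exact: partial_continuous.
by move=> x /hM[].
Qed.

Lemma norm_e3 (i : 'I_3) : `|e3 i : R3 R| = 1.
Proof.
rewrite norm_R3 /e3; case: i => [[|[|[|//]]] ?] /=; rewrite normr1 normr0.
- by rewrite (max_idPl ler01) (max_idPl ler01).
- by rewrite (max_idPr ler01) (max_idPl ler01).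
- by rewrite (max_idPr (_ : Num.max 0 0 <= 1)) // ge_max ler01.
Qed.

(** Along a line in the direction i the partial derivative is the derivative of
    the restriction, which vanishes at both ends of a large segment. *)
Lemma integral_line_partial phi (i : 'I_3) p : test_function phi ->
  (\int[mu]_s (partial i phi (s *: e3 i + p))%:E = 0)%E.
Proof.
move=> tphi; have [M hM] := partial_support i tphi.
pose N : R := `|M| + `|p| + 1.
have Nge (s : R) : N <= `|s| -> M < `|s *: e3 i + p|.
  move=> Ns; apply: (@lt_le_trans _ _ (`|s| - `|p|)).
    by move: (ler_norm M) Ns; rewrite /N; lra.
  have := ler_normB (s *: e3 i + p) p.
  rewrite addrK normrZ norm_e3 mulr1; lra.
have N0 : 0 < N by rewrite ltr_wpDl// addr_ge0.
have dh (s : R) : is_derive s 1 (fun t : R => phi (t *: e3 i + p)) (partial i phi (s *: e3 i + p)).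
  by apply: is_derive_line; exact: test_function_derivable.
have caff : continuous (fun s : R => s *: e3 i + p : R3 R).
  move=> s; apply: cvgD; last exact: cvg_cst.
  by apply: cvgZr_tmp; exact: cvg_id.
have cg : continuous (fun s : R => partial i phi (s *: e3 i + p)).
  move=> s; apply: (@continuous_comp _ _ _ (fun s : R => s *: e3 i + p)); first exact: caff.
  exact: partial_continuous.
have ch : continuous (fun s : R => phi (s *: e3 i + p)).
  by apply: derivable_continuous => s; case: (dh s).
transitivity (\int[mu]_(s in `[(- N)%R, N]) (partial i phi (s *: e3 i + p))%:E)%E.
  rewrite [RHS]integral_mkcond; apply: eq_integral => s _.
  rewrite patchE; case: ifPn => // sN; have [|-> //] := hM (s *: e3 i + p).
  apply: Nge; rewrite leNgt; apply: contra sN => sN.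
  by rewrite inE/= in_itv/= -ler_norml ltW.
rewrite (@continuous_FTC2 _ _ (fun s => phi (s *: e3 i + p))).
- have [|_ ->] := hM (N *: e3 i + p); first by apply: Nge; rewrite gtr0_norm.
  have [|_ ->] := hM (- N *: e3 i + p); first by apply: Nge; rewrite normrN gtr0_norm.
  by rewrite sube0.
- by rewrite gtrN.
- exact: continuous_subspaceT.
- split.
  + by move=> s _; case: (dh s).
  + by apply: cvg_at_right_filter; exact: ch.
  + by apply: cvg_at_left_filter; exact: ch.
- by move=> s _; rewrite derive1E; have [_ ->] := dh s.
Qed.

(** Fubini, integrating first along the direction of the derivative. *)
Lemma integral_partial phi (i : 'I_3) : test_function phi ->
  \int[leb3]_x partial i phi x = 0.
Proof.
move=> tphi; rewrite /Rintegral.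
suff -> : (\int[leb3]_x (partial i phi x)%:E = 0)%E by [].
have ig := partial_integrable i tphi.
have line (a b c s : R) : s *: e3 i + (a, b, c) =
    ((a + s * (i == 0 :> nat)%:R, b + s * (i == 1 :> nat)%:R), c + s * (i == 2 :> nat)%:R) :> R3 R.
  by rewrite /e3; congr (_, _, _); rewrite /= addrC.
have [i2|i2] := eqVneq (i : nat) 2%N.
  rewrite (leb3_fubini12 ig)/=.
  apply: integral0_eq => -[a b] _.
  rewrite -(integral_line_partial i (a, b, 0) tphi); apply: eq_integral => c _.
  by rewrite line i2 /= !mulr0 !addr0 add0r mulr1.
rewrite (leb3_fubini21 ig).
rewrite (@ae_eq_integral _ _ _ mu setT (cst 0%E)) ?integral0//.
  exact: leb3_measurable_fubini ig.
have := leb3_ae_integrable ig; apply: filterS => c ic _.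
have [i0|i0] := eqVneq (i : nat) 0%N.
  rewrite (leb2_fubini21 ic)/=.
  apply: integral0_eq => b _.
  rewrite -(integral_line_partial i (0, b, c) tphi); apply: eq_integral => a _.
  by rewrite line i0 /= !mulr0 !addr0 add0r mulr1.
rewrite (leb2_fubini12 ic)/=.
apply: integral0_eq => a _.
rewrite -(integral_line_partial i (a, 0, c) tphi); apply: eq_integral => b _.
rewrite line (negbTE i0) (negbTE i2) /= !mulr0 !addr0 add0r.
by case: (i) i0 i2 => [[|[|[|//]]]] //=; rewrite mulr1.
Qed.

End test_functions.

(** * Tensor products of one-variable test functions *)

Section tensor_products.
Context {R : realType}.
Implicit Types (F : nat -> R -> R) (x : R3 R).

(** Indexing the factors by natural numbers, with those past 2 ignored, makes
    the derivation and replacement of one factor definable by comparing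
    indices. *)
Definition tens F x : R := F 0 x.1.1 * F 1 x.1.2 * F 2 x.2.

Lemma tens_continuous F : (forall j, continuous (F j)) -> continuous (tens F).
Proof.
move=> cF x.
have c1 : continuous (fun x : R3 R => F 0 x.1.1).
  move=> y; apply: (@continuous_comp _ _ _ (fun x : R3 R => x.1.1 : R)); last exact: cF.
  apply: (@continuous_comp _ _ _ fst fst); exact: cvg_fst.
have c2 : continuous (fun x : R3 R => F 1 x.1.2).
  move=> y; apply: (@continuous_comp _ _ _ (fun x : R3 R => x.1.2 : R)); last exact: cF.
  apply: (@continuous_comp _ _ _ fst snd); [exact: cvg_fst|exact: cvg_snd].
have c3 : continuous (fun x : R3 R => F 2 x.2).
  move=> y; apply: (@continuous_comp _ _ _ (fun x : R3 R => x.2 : R)); last exact: cF.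
  exact: cvg_snd.
apply: cvgM; last exact: c3.
by apply: cvgM; [exact: c1|exact: c2].
Qed.

Definition dtens (i : nat) F : nat -> R -> R :=
  fun j => if j == i then derive1 (F j) else F j.

Lemma is_derive_tens F (i : 'I_3) x : (forall j t, derivable (F j) t 1) ->
  is_derive x (e3 i) (tens F) (tens (dtens i F) x).
Proof.
move=> dF.
have q j (t : R) : (fun h : R => h^-1 *: (F j (h + t) - F j t)) @ 0^' --> derive1 (F j) t.
  have := dF j t; rewrite derive1E => /derivableP[/= + _] => /cvg_ex[l hl].
  rewrite /derive; have := hl; move=> /cvg_lim -> //.
  by move: hl; under eq_fun do rewrite /= [_ *: 1]mulr1.
have main c j t : (forall h : R, h^-1 *: ((tens F \o shift x) (h *: e3 i) - tens F x) =
     h^-1 *: (F j (h + t) - F j t) * c) -> tens (dtens i F) x = derive1 (F j) t * c ->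
   is_derive x (e3 i) (tens F) (tens (dtens i F) x).
  move=> E ->.
  have lim : (fun h : R => h^-1 *: ((tens F \o shift x) (h *: e3 i) - tens F x)) @ 0^' -->
      derive1 (F j) t * c.
    under eq_fun do rewrite E.
    by apply: cvgM; [exact: q|exact: cvg_cst].
  by split; [apply/cvg_ex; exists (derive1 (F j) t * c)|exact/cvg_lim].
case: i main => [[|[|[|//]]] li] main.
- apply: (main (F 1 x.1.2 * F 2 x.2) 0 x.1.1) => [h|]; last by rewrite /tens /dtens/= mulrA.
  rewrite /tens /= /GRing.scale/= !mulr0 !add0r mulr1; ring.
- apply: (main (F 0 x.1.1 * F 2 x.2) 1 x.1.2) => [h|]; last by rewrite /tens /dtens/=; ring.
  rewrite /tens /= /GRing.scale/= !mulr0 !add0r mulr1; ring.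
- apply: (main (F 0 x.1.1 * F 1 x.1.2) 2 x.2) => [h|]; last by rewrite /tens /dtens/=; ring.
  rewrite /tens /= /GRing.scale/= !mulr0 !add0r mulr1; ring.
Qed.

Lemma partial_tens F (i : 'I_3) : (forall j, smooth (F j)) ->
  partial i (tens F) = tens (dtens i F).
Proof.
move=> sF; apply/funext => x; rewrite /partial.
have [_ ->//] := @is_derive_tens F i x (fun j t => smooth_derivable (sF j)).
Qed.

(** The partial derivatives of a tensor product are tensor products. *)
Lemma Cn_tens n F : (forall j, smooth (F j)) -> Cn n (tens F).
Proof.
elim: n F => [|n IH] F sF.
  by apply: tens_continuous => j; exact: smooth_continuous.
split=> [i x|i].
  by case: (@is_derive_tens F i x (fun j t => smooth_derivable (sF j))).
rewrite partial_tens//; apply: IH => j; rewrite /dtens; case: ifP => _ //.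
exact: smooth_derive1.
Qed.

Lemma tens_support F : (forall j, test1 (F j)) ->
  exists M, forall x, M < `|x| -> tens F x = 0.
Proof.
move=> tF; have [_ [M0 h0]] := tF 0; have [_ [M1 h1]] := tF 1; have [_ [M2 h2]] := tF 2.
exists (Num.max (Num.max M0 M1) M2) => x; rewrite norm_R3 !lt_max !gt_max /tens.
move=> /orP[/orP[]|] /andP[/andP[/ltW a /ltW b] /ltW c].
- by rewrite h0// !mul0r.
- by rewrite h1// mulr0 mul0r.
- by rewrite h2// mulr0.
Qed.

Lemma test_function_tens F : (forall j, test1 (F j)) -> test_function (tens F).
Proof.
move=> tF; split; first by move=> n; apply: Cn_tens => j; case: (tF j).
have [M hM] := tens_support tF.
have cC : closed (cube M : set (R3 R)).
  apply: compact_closed; last exact: compact_cube.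
  exact: norm_hausdorff.
apply: (subclosed_compact _ (@compact_cube R M)); first exact: closed_closure.
rewrite [X in _ `<=` X]((closure_id _).1 cC); apply: closureS => x /= Fx.
apply/cubeE; by rewrite leNgt; apply: contra Fx => /hM ->.
Qed.

End tensor_products.

Section dynkin_integral.
Context {d} {X : measurableType d} {R : realType}.
Variable m : {measure set X -> \bar R}.
Context {d'} {Y : measurableType d'}.

(** Dynkin's pi-lambda theorem for the sets A whose preimage has zero integral;
    D is the part of the domain fixed by the coordinates other than [pi]. *)
Lemma integral_preimage_eq0 (G : set (set Y)) (pi : X -> Y) (D : set X)
    (k : X -> \bar R) : @measurable _ Y = <<s G >> -> setI_closed G ->
  measurable_fun setT pi -> measurable D -> m.-integrable setT k ->
  (\int[m]_(x in D) k x = 0)%E ->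
  (forall A, G A -> \int[m]_(x in pi @^-1` A `&` D) k x = 0)%E ->
  forall A, measurable A -> (\int[m]_(x in pi @^-1` A `&` D) k x = 0)%E.
Proof.
move=> YG GI mpi mD ik kD kG A mA.
have mpre B : measurable B -> measurable (pi @^-1` B `&` D).
  by move=> mB; apply: measurableI => //; rewrite -[X in measurable X]setTI; exact: mpi.
have ikS B : measurable B -> m.-integrable B k.
  by move=> mB; apply: integrableS ik.
have sA : <<s G >> A by rewrite -YG.
suff H : forall S, <<s G >> S -> (\int[m]_(x in pi @^-1` S `&` D) k x = 0)%E.
  exact: H.
apply: (@dynkin_induction _ Y G (fun A => \int[m]_(x in pi @^-1` A `&` D) k x = 0)%E YG GI).
- by rewrite preimage_setT setTI.
- exact: kG.
- move=> S mS kS.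
  have DE : D = (pi @^-1` S `&` D) `|` (pi @^-1` (~` S) `&` D).
    by rewrite -setIUl -preimage_setU setUv preimage_setT setTI.
  have mSC : measurable (~` S) by exact: measurableC.
  rewrite -kD [in RHS]DE integral_setU.
  + by rewrite kS add0e.
  + exact: mpre.
  + exact: mpre.
  + by rewrite -DE; apply: measurable_int (ikS _ mD).
  + by apply/disj_setPS => x [[/= Sx _] []].
- move=> F mF tF kF; rewrite preimage_bigcup setI_bigcupl integral_bigcup.
  + by apply: eseries0 => n _ _; exact: kF.
  + apply/trivIsetP => i j _ _ ij; have /trivIsetP := tF => /(_ i j I I ij) Fij.
    by rewrite setIACA -preimage_setI Fij preimage_set0 set0I.
  + by move=> n; exact: mpre.
  + by apply: ikS; apply: bigcupT_measurable => n; exact: mpre.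
Qed.

End dynkin_integral.

(** * The fundamental lemma of the calculus of variations *)

Section fundamental_lemma.
Context {R : realType}.
Local Notation R1 := (measurableTypeR R).
Local Notation R2 := (measurableTypeR R * measurableTypeR R)%type.
Local Notation ocitv := (@ocitv R).

Let ocitvT (A : set R1) := A = setT \/ ocitv A.

(** Boxes are upgraded to measurable sets one factor at a time by
    [integral_preimage_eq0], then two product sigma-algebras are generated by
    their rectangles. The cube D outside of which k vanishes lets the whole
    line stand for an interval, as the induction requires. *)
Lemma boxes_ae_eq0 (k : R3 R -> R) (D : set R1) : ocitv D ->
  (@leb3 R).-integrable setT (EFin \o k) ->
  (forall x, ~ ((D `*` D) `*` D) x -> k x = 0) ->
  (forall A B C, ocitv A -> ocitv B -> ocitv C ->
    (\int[leb3]_(x in (A `*` B) `*` C) (k x)%:E = 0)%E) ->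
  k = cst 0 %[ae leb3].
Proof.
move=> oD ik kD kbox.
have oc_meas A : ocitv A -> measurable (A : set R1).
  by move=> oA; exact: sub_sigma_algebra.
have box0 A B C : ocitvT A -> ocitvT B -> ocitvT C ->
    (\int[leb3]_(x in (A `*` B) `*` C) (k x)%:E = 0)%E.
  move=> oA oB oC.
  have oI E : ocitvT E -> ocitv (E `&` D).
    by case=> [->|oE]; [rewrite setTI|exact: ocitvI].
  rewrite -(kbox _ _ _ (oI _ oA) (oI _ oB) (oI _ oC)).
  rewrite integral_mkcond [RHS]integral_mkcond; apply: eq_integral => x _.
  rewrite !patchE; case: ifPn => [|xA].
    rewrite inE => -[[Ax Bx] Cx]; case: ifPn => // xI.
    rewrite kD// => -[[Dx1 Dx2] Dx3]; move/negP: xI; apply.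
    by rewrite inE.
  case: ifPn => //; rewrite inE => -[[[Ax _] [Bx _]] [Cx _]].
  by move/negP: xA; case; rewrite inE.
have gen : @measurable _ R1 = <<s ocitv >> by [].
have ocT : ocitvT setT by left.
have ocm A : ocitvT A -> measurable A.
  by case=> [->|]; [exact: measurableT|exact: oc_meas].
have m11 : measurable_fun setT (fun x : R3 R => x.1.1 : R1).
  exact: measurableT_comp measurable_fst measurable_fst.
have m12 : measurable_fun setT (fun x : R3 R => x.1.2 : R1).
  exact: measurableT_comp measurable_snd measurable_fst.
have m2 : measurable_fun setT (fun x : R3 R => x.2 : R1) by exact: measurable_snd.
have e1 (A B C : set R1) : (fun x : R3 R => x.1.1 : R1) @^-1` A `&` ((setT `*` B) `*` C) = (A `*` B) `*` C.
  by apply/seteqP; split=> x /= => [[? [[_ ?] ?]]|[[? ?] ?]].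
have e2 (A B C : set R1) : (fun x : R3 R => x.1.2 : R1) @^-1` B `&` ((A `*` setT) `*` C) = (A `*` B) `*` C.
  by apply/seteqP; split=> x /= => [[? [[? _] ?]]|[[? ?] ?]].
have e3 (A B C : set R1) : (fun x : R3 R => x.2 : R1) @^-1` C `&` ((A `*` B) `*` setT) = (A `*` B) `*` C.
  by apply/seteqP; split=> x /= => [[? [[? ?] _]]|[[? ?] ?]].
have s1 A B C : measurable A -> ocitvT B -> ocitvT C ->
    (\int[leb3]_(x in (A `*` B) `*` C) (k x)%:E = 0)%E.
  move=> mA oB oC; rewrite -e1.
  apply: (integral_preimage_eq0 gen (@ocitvI R) m11 _ ik _ _ mA).
  - by apply: measurableX; [apply: measurableX => //|]; exact: ocm.
  - exact: box0.
  - by move=> A' oA'; rewrite e1; apply: box0 => //; right.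
have s2 A B C : measurable A -> measurable B -> ocitvT C ->
    (\int[leb3]_(x in (A `*` B) `*` C) (k x)%:E = 0)%E.
  move=> mA mB oC; rewrite -e2.
  apply: (integral_preimage_eq0 gen (@ocitvI R) m12 _ ik _ _ mB).
  - by apply: measurableX; [apply: measurableX => //|exact: ocm].
  - exact: s1.
  - by move=> B' oB'; rewrite e2; apply: s1 => //; right.
have s3 A B C : measurable A -> measurable B -> measurable C ->
    (\int[leb3]_(x in (A `*` B) `*` C) (k x)%:E = 0)%E.
  move=> mA mB mC; rewrite -e3.
  apply: (integral_preimage_eq0 gen (@ocitvI R) m2 _ ik _ _ mC).
  - by apply: measurableX => //; exact: measurableX.
  - exact: s2.
  - by move=> C' oC'; rewrite e3; apply: s2 => //; right.
have s4 (S : set R2) C : measurable S -> measurable C ->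
    (\int[leb3]_(x in S `*` C) (k x)%:E = 0)%E.
  move=> mS mC.
  have e4 (S' : set R2) : (fst : R3 R -> R2) @^-1` S' `&` (setT `*` C) = S' `*` C.
    by apply/seteqP; split=> x /= => [[? [_ ?]]|[? ?]].
  rewrite -e4; apply: (integral_preimage_eq0 (measurable_prod_measurableType R1 R1) _ _ _ ik _ _ mS).
  - move=> _ _ [A mA [B mB <-]] [A' mA' [B' mB' <-]].
    exists (A `&` A'); first exact: measurableI.
    by exists (B `&` B'); [exact: measurableI|rewrite setXI].
  - exact: measurable_fst.
  - exact: measurableX.
  - by rewrite -setXTT; exact: s3.
  - by move=> _ [A mA [B mB <-]]; rewrite e4; exact: s3.
have s5 (S : set (R3 R)) : measurable S -> (\int[leb3]_(x in S) (k x)%:E = 0)%E.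
  move=> mS; have -> : S = id @^-1` S `&` setT by rewrite setIT.
  apply: (integral_preimage_eq0 (measurable_prod_measurableType R2 R1) _ _ _ ik _ _ mS).
  - move=> _ _ [A mA [B mB <-]] [A' mA' [B' mB' <-]].
    exists (A `&` A'); first exact: measurableI.
    by exists (B `&` B'); [exact: measurableI|rewrite setXI].
  - exact: measurable_id.
  - exact: measurableT.
  - by rewrite -setXTT; exact: s4.
  - by move=> _ [A mA [B mB <-]]; rewrite setIT; exact: s4.
have /= : ae_eq leb3 setT (EFin \o k) (EFin \o cst 0).
  apply: integral_ae_eq; [exact: measurableT|exact: ik|exact/measurable_EFinP/measurable_cst|].
  by move=> E _ mE; rewrite s5// integral0.
by apply: filterS => x + _ => /(_ I) [].
Qed.

(** The support extends to the right of b by 1 / (n + 1) to keep b inside. The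
    parameter is (1 / (n + 1))^2, small enough for the second exponent
    c / (b + 1 / (n + 1) - x), which is at most c (n + 1), to vanish at the
    limit also for x = b. *)
Lemma cvg_bump (a b x : R) :
  bump a (b + n.+1%:R^-1) (n.+1%:R^-1 ^+ 2) x @[n --> \oo] -->
  (\1_(`]a, b]%classic : set R) x : R).
Proof.
have d0 n : 0 < n.+1%:R^-1 :> R by rewrite invr_gt0 ltr0n.
have dcvg : n.+1%:R^-1 @[n --> \oo] --> (0 : R) by exact: cvg_harmonic.
have [xa|ax] := leP x a.
  rewrite indicE memNset/=; last by rewrite in_itv/= ltNge xa.
  rewrite (_ : (fun n => _) = cst 0); first exact: cvg_cst.
  by apply/funext => n; rewrite bump_out// xa.
have [xb|bx] := leP x b; last first.
  rewrite indicE memNset/=; last by rewrite in_itv/= leNgt bx andbF.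
  apply: cvg_near_cst; near=> n; apply: bump_out; apply/orP; right.
  rewrite -lerBrDl; near: n.
  by apply: (cvgr_le _ dcvg); rewrite subr_gt0.
rewrite indicE mem_set/=; last by rewrite in_itv/= ax xb.
have xa0 : 0 < x - a by rewrite subr_gt0.
apply: (@squeeze_cvgr _ _ _ _
  (fun n => expR (- (n.+1%:R^-1 ^+ 2 / (x - a))) * expR (- n.+1%:R^-1)) (cst 1)).
- apply: nearW => n; rewrite bump_le1 ?exprn_gt0// andbT.
  have xbd : x < b + n.+1%:R^-1 by rewrite (le_lt_trans xb)// ltrDl.
  rewrite bumpE// ler_wpM2l ?expR_ge0// ler_expR lerN2.
  rewrite ler_pdivrMr ?subr_gt0// expr2; apply: ler_wpM2l; first exact: ltW.
  by rewrite addrAC lerDr subr_ge0.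
- rewrite [X in _ --> X](_ : 1 = expR (- (0 ^+ 2 / (x - a))) * expR (- 0)); last first.
    by rewrite expr0n/= mul0r oppr0 expR0 mulr1.
  apply: cvgM.
    apply: continuous_cvg; first exact: continuous_expR.
    apply: cvgN; apply: cvgM; last exact: cvg_cst.
    exact: (cvgM dcvg dcvg).
  apply: continuous_cvg; first exact: continuous_expR.
  exact: cvgN.
- exact: cvg_cst.
Unshelve. all: by end_near. Qed.

Definition boxF (a b : nat -> R) (n j : nat) : R -> R :=
  bump (a j) (b j + n.+1%:R^-1) (n.+1%:R^-1 ^+ 2).

Lemma test1_boxF a b n j : test1 (boxF a b n j).
Proof. by apply: test1_bump; rewrite exprn_gt0// invr_gt0 ltr0n. Qed.

Lemma locally_integrable_mul (g f : R3 R -> R) M : locally_integrable3 g ->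
  measurable_fun setT f -> (exists N, forall x, `|f x| <= N) ->
  (forall x, M < `|x| -> f x = 0) ->
  (@leb3 R).-integrable setT (EFin \o (fun x => g x * f x)).
Proof.
move=> lg mf [N fN] fM.
have ig := lg _ (@compact_cube R M).
have -> : EFin \o (fun x => g x * f x) = (EFin \o (fun x => g x * f x)) \_ (cube M).
  apply/funext => x; rewrite patchE; case: ifPn => //= xM; rewrite fM ?mulr0//.
  by rewrite ltNge; apply: contra xM => xM; rewrite inE; exact/cubeE.
apply/integrable_restrict => //=; first exact: measurable_cube.
rewrite setTI.
have -> : EFin \o (fun x => g x * f x) = (fun x => (EFin \o g) x * (f x)%:E)%E by [].
apply: integrableMl => //; first exact: measurable_cube.
- exact: measurable_funTS.
- by exists N; split; [exact: num_real|move=> y Ny x _ /=; rewrite (le_trans (fN x))// ltW].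
Qed.

Lemma locally_integrable_mul_continuous (g f : R3 R -> R) M :
  locally_integrable3 g -> continuous f -> (forall x, M < `|x| -> f x = 0) ->
  (@leb3 R).-integrable setT (EFin \o (fun x => g x * f x)).
Proof.
move=> lg cf fM.
apply: (@locally_integrable_mul _ _ M) => //; first exact: continuous_measurable_R3.
have : compact (f @` cube M).
  by apply: continuous_compact (@compact_cube R M); exact: continuous_subspaceT.
move=> /compact_bounded[N [_ hN]]; exists (Num.max 0 (N + 1)) => x.
have [xM|Mx] := leP `|x| M; last by rewrite fM// normr0 le_max lexx.
rewrite le_max; apply/orP; right; apply: (hN (N + 1)); first by rewrite ltrDl.
by exists x => //; exact/cubeE.
Qed.

(** By dominated convergence along bump functions g has zero integral over every
    box; apply [boxes_ae_eq0] to the restrictions of g to an exhausting sequence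
    of cubes, on which g is integrable. *)
Theorem fundamental_lemma (g : R3 R -> R) : locally_integrable3 g ->
  (forall F, (forall j, test1 (F j)) -> \int[leb3]_x (g x * tens F x) = 0) ->
  g = cst 0 %[ae leb3].
Proof.
move=> lg g0.
have box A B C : ocitv A -> ocitv B -> ocitv C ->
    (\int[leb3]_(x in (A `*` B) `*` C) (g x)%:E = 0)%E.
  move=> [[a1 b1] _ <-] [[a2 b2] _ <-] [[a3 b3] _ <-] /=.
  pose a (j : nat) := nth 0 [:: a1; a2; a3] j.
  pose b (j : nat) := nth 0 [:: b1; b2; b3] j.
  set E := (_ `*` _) `*` _.
  (* a cube containing the supports of all the approximations, as 1 / (n + 1) <= 1 *)
  pose M := \big[Num.max/0]_(j < 3) Num.max `|a j| `|b j + 1|.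
  have aM j : (j < 3)%N -> `|a j| <= M.
    by move=> j3; apply: (bigmax_sup (Ordinal j3)) => //; rewrite le_max lexx.
  have bM j : (j < 3)%N -> `|b j + 1| <= M.
    by move=> j3; apply: (bigmax_sup (Ordinal j3)) => //; rewrite le_max lexx orbT.
  have out n j y : (j < 3)%N -> M < `|y| -> boxF a b n j y = 0.
    move=> j3 My; apply: bump_out.
    have [y0|y0] := leP 0 y.
      rewrite ger0_norm// in My; apply/orP; right.
      have h : n.+1%:R^-1 <= 1 :> R by rewrite invf_le1// ler1n.
      rewrite (le_trans _ (ltW My))// (le_trans _ (bM j j3))//.
      by rewrite (le_trans _ (ler_norm _))// lerD2l.
    rewrite ltr0_norm// in My; apply/orP; left.
    by have := aM j j3; have := ler_norm (- a j); rewrite normrN; lra.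
  have tout n x : M < `|x| -> tens (boxF a b n) x = 0.
    rewrite norm_R3 !lt_max /tens => /orP[/orP[]|] h; rewrite (out n _ _ _ h) //.
    - by rewrite !mul0r.
    - by rewrite mulr0 mul0r.
    - by rewrite mulr0.
  have b_ge0 n j y : 0 <= boxF a b n j y by exact: bump_ge0.
  have b_le1 n j y : boxF a b n j y <= 1.
    by rewrite bump_le1// exprn_gt0// invr_gt0 ltr0n.
  have t1 n x : `|tens (boxF a b n) x| <= 1.
    have p0 : 0 <= boxF a b n 0 x.1.1 * boxF a b n 1 x.1.2 by exact: mulr_ge0.
    have p1 : boxF a b n 0 x.1.1 * boxF a b n 1 x.1.2 <= 1 by exact: mulr_ile1.
    by rewrite /tens ger0_norm; [exact: mulr_ile1|exact: mulr_ge0].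
  have mt n : measurable_fun setT (tens (boxF a b n)).
    apply: continuous_measurable_R3; apply: tens_continuous => j.
    by apply: smooth_continuous; case: (test1_boxF a b n j).
  have ig n := locally_integrable_mul lg (mt n) (ex_intro _ 1 (t1 n)) (tout n).
  have mE : measurable E by apply: measurableX => //; exact: measurableX.
  have EM : E `<=` cube M.
    move=> x [[/=]]; rewrite !in_itv/= => /andP[h1 h2] /andP[h3 h4] /andP[h5 h6].
    apply/cubeE; rewrite norm_R3_le !ler_norml.
    have [k1 k2] := (aM 0 isT, bM 0 isT); have [k3 k4] := (aM 1 isT, bM 1 isT).
    have [k5 k6] := (aM 2 isT, bM 2 isT).
    rewrite !ler_norml /a /b /= in k1 k2 k3 k4 k5 k6.
    by lra.
  have iM := lg _ (@compact_cube R M).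
  have [] := @dominated_convergence _ _ _ leb3 setT measurableT
    (fun n x => (g x * tens (boxF a b n) x)%:E) ((EFin \o g) \_ E)
    ((abse \o (EFin \o g)) \_ (cube M)).
  - by move=> n; exact: measurable_int (ig n).
  - apply/(measurable_restrictT _ mE); apply: measurable_funS EM _; first exact: measurable_cube.
    exact: measurable_int iM.
  - apply: aeW => x _.
    have -> : ((EFin \o g) \_ E) x = (g x * (\1_(`]a1, b1]%classic : set R) x.1.1 *
        \1_(`]a2, b2]%classic : set R) x.1.2 *
        \1_(`]a3, b3]%classic : set R) x.2))%:E.
      rewrite patchE !indicE -!mulnb -!natrM !mulnb.
      rewrite (_ : x \in E = [&& x.1.1 \in `]a1, b1]%classic,
          x.1.2 \in `]a2, b2]%classic & x.2 \in `]a3, b3]%classic]).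
        by rewrite andbA; case: ifP => _; rewrite ?mulr1 ?mulr0.
      by apply/idP/and3P => [/set_mem[[/= h1 h2] h3]|[/set_mem h1 /set_mem h2 /set_mem h3]];
        [split; exact/mem_set|apply/mem_set].
    apply: cvg_EFin; first exact: nearW.
    apply: cvgM; first exact: cvg_cst.
    rewrite /tens; apply: cvgM; last exact: cvg_bump.
    by apply: cvgM; exact: cvg_bump.
  - apply/integrable_restrict => //; first exact: measurable_cube.
    by rewrite setTI; exact: integrable_abse.
  - apply: aeW => x n _; rewrite patchE; case: ifPn => xM.
      by rewrite /= lee_fin normrM ler_piMr.
    have Mx : M < `|x|.
      by rewrite ltNge; apply: contra xM => xM; rewrite inE; exact/cubeE.
    by rewrite tout// mulr0/= normr0.
  move=> _ _; rewrite [X in _ --> X -> _](_ : _ = (\int[leb3]_(x in E) (g x)%:E)%E); last first.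
    by rewrite [RHS]integral_mkcond.
  have -> : (fun n => \int[leb3]_x (g x * tens (boxF a b n) x)%:E)%E = cst 0%E.
    apply/funext => n; rewrite -(fineK (integrable_fin_num measurableT (ig n))).
    by congr _%:E; apply: g0 => j; exact: test1_boxF.
  by move=> h; apply: (cvg_unique _ h); [exact: ereal_hausdorff|exact: cvg_cst].
pose D n : set R1 := `](- n%:R), n%:R]%classic.
have oD n : ocitv (D n) by exists (- n%:R, n%:R).
pose D3 n := (D n `*` D n) `*` D n.
have mDn n : measurable (D n) by exact: measurable_itv.
have mD n : measurable (D3 n) by apply: measurableX => //; exact: measurableX.
have DM n : D3 n `<=` cube n%:R.
  move=> x [[/=]]; rewrite /D/= !in_itv/= => /andP[h1 h2] /andP[h3 h4] /andP[h5 h6].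
  by apply/cubeE; rewrite norm_R3_le !ler_norml (ltW h1) h2 (ltW h3) h4 (ltW h5) h6.
have key n : (g \_ (D3 n)) = cst 0 %[ae leb3].
  apply: (@boxes_ae_eq0 _ (D n)) => //.
  - rewrite -restrict_EFin; apply/integrable_restrict => //=.
    rewrite setTI; apply: integrableS (lg _ (@compact_cube R n%:R)) => //.
    exact: measurable_cube.
  - by move=> x xD; rewrite patchE memNset.
  - move=> A B C oA oB oC.
    have := box _ _ _ (ocitvI oA (oD n)) (ocitvI oB (oD n)) (ocitvI oC (oD n)).
    rewrite (_ : _ `*` (C `&` D n) = (A `*` B `*` C) `&` D3 n); last first.
      by apply/seteqP; split=> x /= => [[[[? ?] [? ?]] [? ?]]|[[[? ?] ?] [[? ?] ?]]].
    rewrite integral_mkcondr => h; rewrite -[RHS]h; apply: eq_integral => x _.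
    by rewrite !patchE; case: ifP.
have /ae_foralln := key; apply: filterS => x h _.
have := h (Num.truncn `|x|).+1; rewrite patchE mem_set => [/(_ I)//|].
have := truncnS_gt `|x|; rewrite norm_R3_lt => /and3P[].
rewrite !ltr_norml => /andP[h1 h2] /andP[h3 h4] /andP[h5 h6].
by rewrite /D3 /D /= !in_itv/= h1 (ltW h2) h3 (ltW h4) h5 (ltW h6).
Qed.

End fundamental_lemma.

(** * Locally integrable functions with null gradient *)

Section null_gradient.
Context {R : realType}.
Local Notation mu := (@lebesgue_measure R).
Implicit Types (u : R3 R -> R) (F : nat -> R -> R) (e f : R -> R).

Lemma compact_measurable_R3 (K : set (R3 R)) : compact K -> measurable K.
Proof.
move=> cK; rewrite -(setCK K); apply: measurableC; apply: open_measurable_R3.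
by rewrite openC; apply: compact_closed cK; exact: norm_hausdorff.
Qed.

Lemma locally_integrable_cst (c : R) : locally_integrable3 (cst c : R3 R -> R).
Proof.
move=> K cK.
have mK := compact_measurable_R3 cK.
have [M [_ hM]] := compact_bounded cK.
have KM : K `<=` cube (M + 1).
  by move=> x Kx; apply/cubeE; apply: hM Kx; rewrite ltrDl.
apply: (integrableS (@measurable_cube R (M + 1)) mK KM).
apply: measurable_bounded_integrable => //; first exact: measurable_cube.
  exact: leb3_cube_lty.
exact: bounded_cst.
Qed.

Lemma locally_integrableB u v : locally_integrable3 u -> locally_integrable3 v ->
  locally_integrable3 (fun x : R3 R => u x - v x : R).
Proof.
move=> lu lv K cK.
have mK := compact_measurable_R3 cK.
by have := integrableB mK (lu K cK) (lv K cK).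
Qed.

Lemma locally_integrable_test u F : locally_integrable3 u ->
  (forall j, test1 (F j)) ->
  (@leb3 R).-integrable setT (EFin \o (fun x => u x * tens F x)).
Proof.
move=> lu tF; have [M hM] := tens_support tF.
apply: (locally_integrable_mul_continuous lu _ hM).
by apply: tens_continuous => j; apply: smooth_continuous; case: (tF j).
Qed.

Definition upd (j : nat) F f : nat -> R -> R := fun k => if k == j then f else F k.

Lemma test1_upd j F f : (forall k, test1 (F k)) -> test1 f ->
  forall k, test1 (upd j F f k).
Proof. by move=> tF tf k; rewrite /upd; case: ifP. Qed.

Lemma tens_upd_lin (j : 'I_3) F f g (c : R) (x : R3 R) :
  tens (upd j F (fun t => f t - c * g t)) x =
  tens (upd j F f) x - c * tens (upd j F g) x.
Proof. by case: j => [[|[|[|//]]] ?]; rewrite /tens /upd/=; ring. Qed.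

Lemma tens_upd_id (j : nat) F : tens (upd j F (F j)) = tens F.
Proof.
congr tens; apply/funext => k; rewrite /upd; by case: eqP => // ->.
Qed.

Variable u : R3 R -> R.
Hypothesis lu : locally_integrable3 u.
Hypothesis du : forall (i : 'I_3) phi, test_function phi ->
  \int[leb3]_x (u x * partial i phi x) = 0.

(** F_j minus its integral times e has mean zero, hence is the derivative of a
    test function of one variable; the corresponding tensor product is a
    partial derivative, against which u integrates to zero. *)
Lemma null_gradient_upd (j : 'I_3) F e : (forall k, test1 (F k)) -> test1 e ->
  \int[mu]_t e t = 1 ->
  \int[leb3]_x (u x * tens F x) =
  \int[mu]_t F j t * \int[leb3]_x (u x * tens (upd j F e) x).
Proof.
move=> tF te e1; set c := \int[mu]_t F j t.
pose psi t := F j t - c * e t.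
have tpsi : test1 psi.
  rewrite /psi (_ : (fun _ => _) = fun t => F j t + (- c) * e t).
    by apply: test1D => //; exact: test1Z.
  by apply/funext => t; rewrite mulNr.
have psi0 : \int[mu]_t psi t = 0.
  rewrite RintegralB//; last 2 first.
  - exact: test1_integrable.
  - exact: (test1_integrable (test1Z c te)).
  by rewrite RintegralZl//; [rewrite e1 mulr1 subrr|exact: test1_integrable].
have [Psi tPsi dPsi] := test1_primitive tpsi psi0.
have tU := test1_upd j tF tPsi.
have := du j (test_function_tens tU).
rewrite partial_tens; last by move=> k; have [] := tU k.
rewrite (_ : dtens j (upd j F Psi) = upd j F psi); last first.
  by apply/funext => k; rewrite /dtens /upd; case: eqP => // _; rewrite dPsi.
have i1 := locally_integrable_test lu tF.
have i2 := locally_integrable_test lu (test1_upd j tF te).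
under eq_Rintegral do rewrite tens_upd_lin tens_upd_id mulrBr (mulrCA _ c).
rewrite RintegralB//; last first.
  exact: (integrableZl measurableT c i2).
by rewrite RintegralZl// => /eqP; rewrite subr_eq0 => /eqP.
Qed.

Lemma null_gradient_tens F e : (forall k, test1 (F k)) -> test1 e ->
  \int[mu]_t e t = 1 ->
  \int[leb3]_x (u x * tens F x) =
  \int[mu]_t F 0 t * (\int[mu]_t F 1 t * (\int[mu]_t F 2 t *
    \int[leb3]_x (u x * tens (fun=> e) x))).
Proof.
move=> tF te e1.
have t0 := test1_upd 0 tF te; have t1 := test1_upd 1 t0 te.
rewrite (null_gradient_upd (Ordinal (isT : 0 < 3)%N) tF te e1)/=.
rewrite (null_gradient_upd (Ordinal (isT : 1 < 3)%N) t0 te e1)/=.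
by rewrite (null_gradient_upd (Ordinal (isT : 2 < 3)%N) t1 te e1).
Qed.

End null_gradient.

Section null_gradient_constant.
Context {R : realType}.
Local Notation mu := (@lebesgue_measure R).

(** The positivity on (0, 1) makes the integral of the tensor cube of e, taken
    over the space, positive. *)
Lemma mollifier : exists e : R -> R, [/\ test1 e, \int[mu]_t e t = 1,
  (forall t, 0 <= e t) & (forall t, 0 < t < 1 -> 0 < e t)].
Proof.
have tb : test1 (bump 0 1 1 : R -> R) by exact: test1_bump.
have ib := test1_integrable tb.
have b0 t : 0 < t < 1 -> 0 < bump 0 1 1 t :> R.
  by move=> /andP[t0 t1]; rewrite bumpE// mulr_gt0 ?expR_gt0.
have I0 : 0 < \int[mu]_t (bump 0 1 1 t : R).
  rewrite lt_neqAle Rintegral_ge0 ?andbT; last by move=> t _; exact: bump_ge0.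
  have bge0 (t : measurableTypeR R) : 0 <= bump 0 1 1 t by exact: bump_ge0.
  apply/negP => /eqP/esym /(ge0_Rintegral_eq0 bge0 ib).
  move=> [N [mN N0 hN]].
  have : (mu (`]0%R, 1%R[%classic : set R) <= mu N)%E.
    apply: le_measure; [by rewrite inE; exact: measurable_itv|by rewrite inE|].
    move=> t /=; rewrite in_itv/= => /b0 bt; apply: hN => /= /(_ I) /eqP.
    by rewrite gt_eqF.
  by rewrite N0 lebesgue_measure_itv/= lte01 oppr0 adde0 leNgt lte01.
exists (fun t => (\int[mu]_t bump 0 1 1 t)^-1 * bump 0 1 1 t); split.
- exact: test1Z.
- by rewrite RintegralZl// mulVf// gt_eqF.
- by move=> t; rewrite mulr_ge0 ?bump_ge0// invr_ge0 ltW.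
- by move=> t /b0 bt; rewrite mulr_gt0// invr_gt0.
Qed.

(** The constant c is the ratio of the integrals of u and 1 against the tensor
    cube of e. Then u - c has null gradient and zero integral against this
    tensor cube, hence against all tensor products by [null_gradient_tens]. *)
Theorem null_gradient_ae_cst (u : R3 R -> R) : locally_integrable3 u ->
  (forall (i : 'I_3) phi, test_function phi ->
    \int[leb3]_x (u x * partial i phi x) = 0) ->
  exists c, u = cst c %[ae leb3].
Proof.
move=> lu du.
have [e [te e1 e0 ep]] := mollifier.
have tE : forall j : nat, test1 ((fun=> e) j) by [].
have l1 := locally_integrable_cst (1 : R).
have iV := locally_integrable_test l1 tE.
have V0 : 0 < \int[leb3]_x ((cst 1 : R3 R -> R) x * tens (fun=> e) x).
  have pos x : 0 <= (cst 1 : R3 R -> R) x * tens (fun=> e) x.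
    by rewrite mul1r /tens !mulr_ge0.
  rewrite lt_neqAle Rintegral_ge0 ?andbT//.
  apply/negP => /eqP/esym /(ge0_Rintegral_eq0 pos iV) [N [mN N0 hN]].
  pose J : set (measurableTypeR R) := `]0%R, 1%R[%classic.
  have mJ : measurable J by exact: measurable_itv.
  have : (leb3 ((J `*` J) `*` J) <= leb3 N)%E.
    apply: le_measure; [rewrite inE|by rewrite inE|].
      by apply: measurableX => //; exact: measurableX.
    move=> x [[/=]]; rewrite /J/= !in_itv/= => /ep h1 /ep h2 /ep h3.
    by apply: hN => /= /(_ I) /eqP; rewrite mul1r gt_eqF// /tens !mulr_gt0.
  rewrite N0 /leb3 product_measure1E//=; last exact: measurableX.
  rewrite product_measure1E//= lebesgue_measure_itv/= lte01 oppr0 adde0 !mule1.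
  by rewrite leNgt lte01.
pose c := \int[leb3]_x (u x * tens (fun=> e) x) /
  \int[leb3]_x ((cst 1 : R3 R -> R) x * tens (fun=> e) x).
have lv : locally_integrable3 (fun x => u x - cst c x).
  exact: locally_integrableB lu (locally_integrable_cst c).
exists c.
suff : (fun x => u x - cst c x) = cst 0 %[ae leb3].
  by apply: filterS => x + _ => /(_ I)/eqP; rewrite subr_eq0 => /eqP.
have iuE := locally_integrable_test lu tE.
have dv (i : 'I_3) phi : test_function phi ->
    \int[leb3]_x ((u x - cst c x) * partial i phi x) = 0.
  move=> tphi.
  have [M hM] := partial_support i tphi.
  under eq_Rintegral do rewrite mulrBl.
  have ip := partial_integrable i tphi.
  rewrite RintegralB//.
  - by rewrite du// sub0r RintegralZl// integral_partial// mulr0 oppr0.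
  - apply: (@locally_integrable_mul_continuous _ _ _ M) => //.
      exact: partial_continuous.
    by move=> x /hM[].
  - by have := integrableZl measurableT c ip.
apply: fundamental_lemma => // F tF.
rewrite (null_gradient_tens lv dv tF te e1) [X in _ * (_ * (_ * X))](_ : _ = 0) ?mulr0//.
under eq_Rintegral do rewrite mulrBl.
rewrite RintegralB//; last first.
  by have := locally_integrable_test (locally_integrable_cst c) tE.
rewrite [X in _ - X](_ : _ = c * \int[leb3]_x ((cst 1 : R3 R -> R) x * tens (fun=> e) x)).
  by rewrite /c divfK ?subrr// gt_eqF.
rewrite -RintegralZl//; apply: eq_Rintegral => x _.
by rewrite /= mul1r.
Qed.

End null_gradient_constant.

(** * The weighted Dirichlet form *)

Section form.
Context {R : realType}.
Variable gamma : R.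
Hypothesis gamma_gt0 : 0 < gamma.
Local Notation m := (psi_measure gamma).
Local Notation L2 u := (u \in Lfun m 2%:E).

Lemma psi_measurable_sqr : measurable_fun setT (fun x => (psi gamma x ^+ 2)%:E).
Proof.
by apply/measurable_EFinP; apply: measurable_funX; exact: measurable_psi.
Qed.

Lemma psi_gt0 (x : R3 R) : x != 0 -> 0 < psi gamma x ^+ 2.
Proof.
move=> x0; rewrite psi_sqrE//.
suff e0 : 0 < enorm x.
  by rewrite mulr_gt0 ?divr_gt0 ?expR_gt0 ?exprn_gt0// mulr_gt0// pi_gt0.
rewrite sqrtr_gt0 lt_neqAle !addr_ge0 ?sqr_ge0// andbT eq_sym.
apply: contra x0; rewrite !paddr_eq0 ?addr_ge0 ?sqr_ge0// !sqrf_eq0.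
by case: x => [[a b] c] /= /andP[/andP[/eqP-> /eqP->] /eqP->].
Qed.

Lemma leb3_null_psi_null (N : set (R3 R)) : measurable N ->
  leb3 N = 0%E -> m N = 0%E.
Proof.
move=> mN N0; apply: (null_set_integral mN _ N0).
by apply: measurable_funTS; exact: psi_measurable_sqr.
Qed.

(** The density psi^2 is positive except at the origin, a null set. *)
Lemma psi_null_leb3_null (N : set (R3 R)) : measurable N ->
  m N = 0%E -> leb3 N = 0%E.
Proof.
move=> mN N0.
have mp : measurable_fun N (fun x => (psi gamma x ^+ 2)%:E).
  by apply: measurable_funTS; exact: psi_measurable_sqr.
have : (\int[leb3]_(x in N) `|(psi gamma x ^+ 2)%:E| = 0)%E.
  by under eq_integral do rewrite gee0_abs ?lee_fin ?sqr_ge0//.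
move=> /(ae_eq_integral_abs _ mN mp) h.
have n0 : (@leb3 R).-negligible [set 0].
  exists [set 0]; split => //; [exact: measurable_set1_R3|exact: leb3_set1].
apply/negligibleP => //.
apply: negligibleS (negligibleU h n0) => x Nx.
have [->|x0] := eqVneq x 0; [by right|left => /= /(_ Nx) [] /eqP].
by rewrite gt_eqF// psi_gt0.
Qed.

Lemma ae_leb3_psi (P : R3 R -> Prop) : {ae leb3, forall x, P x} -> {ae m, forall x, P x}.
Proof. by move=> [N [mN N0 hN]]; exists N; split => //; exact: leb3_null_psi_null. Qed.

Lemma ae_psi_leb3 (P : R3 R -> Prop) : {ae m, forall x, P x} -> {ae leb3, forall x, P x}.
Proof. by move=> [N [mN N0 hN]]; exists N; split => //; exact: psi_null_leb3_null. Qed.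

(** The difference of two gradients integrates to zero against every tensor
    product of test functions. *)
Lemma distributional_gradient_unique (u : R3 R -> R) g g' :
  distributional_gradient u g -> distributional_gradient u g' ->
  forall i, g i = g' i %[ae leb3].
Proof.
move=> [_ dg] [_ dg'] i; have [lg hg] := dg i; have [lg' hg'] := dg' i.
suff : (fun x => g i x - g' i x) = cst 0 %[ae leb3].
  by apply: filterS => x + _ => /(_ I)/eqP; rewrite subr_eq0 => /eqP.
apply: fundamental_lemma; first exact: locally_integrableB.
move=> F tF; have tphi := test_function_tens tF.
under eq_Rintegral do rewrite mulrBl.
rewrite RintegralB//; [|exact: locally_integrable_test|exact: locally_integrable_test].
by rewrite -[X in X - _]opprK -hg// -[X in _ - X]opprK -hg'// subrr.
Qed.

Lemma gradP (u : R3 R -> R) g : distributional_gradient u g ->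
  distributional_gradient u (grad u).
Proof.
move=> dg; apply: (@xgetPex _ (fun=> cst 0) [set g | distributional_gradient u g]).
by exists g.
Qed.

(** [grad u] is a gradient picked by choice, about which only the existence of
    one gradient is known; uniqueness identifies it up to null sets. *)
Lemma grad_ae (u : R3 R -> R) g i : distributional_gradient u g ->
  grad u i = g i %[ae m].
Proof.
move=> dg; apply: ae_leb3_psi.
exact: (distributional_gradient_unique (gradP dg) dg).
Qed.

Lemma distributional_gradient_cst (c : R) :
  distributional_gradient (cst c) (fun=> cst 0).
Proof.
split; first exact: locally_integrable_cst.
move=> i; split; first exact: locally_integrable_cst.
move=> phi tphi; rewrite RintegralZl//; last exact: partial_integrable.
rewrite integral_partial// mulr0.
under eq_Rintegral do rewrite mul0r.
by rewrite Rintegral_cst// mul0r oppr0.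
Qed.

Let m1 := psi_measure_setT gamma_gt0.

Lemma form_domain_cst c : form_domain gamma (cst c).
Proof.
split; first exact: (L2_cst m1).
exists (fun=> cst 0); first exact: distributional_gradient_cst.
by move=> i; exact: (L2_cst m1).
Qed.

Lemma energy_cst c (v : R3 R -> R) : energy gamma (cst c) v = 0.
Proof.
rewrite /energy (@ae_eq_Rintegral_nonmeasurable _ _ _ m _ (cst 0))//.
  by rewrite Rintegral_cst// mul0r mulr0.
have g0 i := grad_ae i (distributional_gradient_cst c).
have : {ae m, forall x, forall i : 'I_3, grad (cst c) i x = 0}.
  apply: filter_forall => i; apply: filterS (g0 i) => x; exact.
by apply: filterS => x h _; rewrite big1// => i _; rewrite h mul0r.
Qed.

Variable T : R -> (R3 R -> R) -> (R3 R -> R).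
Hypothesis T_of_form : semigroup_of_form m (form_domain gamma) (energy gamma) T.

(** Constants lie in the form domain with E (1, v) = 0 = (0, v) for all v, so
    the generator sends 1 to 0. *)
Lemma form_conservative : conservative m T.
Proof.
move=> t t0; have [msgT genT] := T_of_form.
apply: (generator_fixed m1 msgT (L2_cst m1 1) _ t0).
apply/(genT _ _ (L2_cst m1 1) (L2_cst m1 0)); split; first exact: form_domain_cst.
move=> v _; rewrite energy_cst /L2inner.
under eq_Rintegral do rewrite /= oppr0 mul0r.
by rewrite Rintegral_cst// mul0r.
Qed.

(** A fixed vector w is in the form domain and E (w, w) = 0, an integral of a sum
    of squares: the gradient of w is null. *)
Lemma form_fixed_cst w : L2 w -> (forall t, 0 < t -> T t w = w %[ae m]) ->
  exists c, w = cst c %[ae m].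
Proof.
move=> lw fw; have [msgT genT] := T_of_form.
have := fixed_generator m1 msgT lw fw.
move=> /(genT _ _ lw (L2_cst m1 0)) [Fw /(_ _ Fw)].
have [_ [g dg lg]] := Fw.
rewrite /L2inner; under [RHS]eq_Rintegral do rewrite /= oppr0 mul0r.
rewrite Rintegral_cst// mul0r => /eqP.
rewrite /energy mulf_eq0 invr_eq0 pnatr_eq0/= => /eqP.
have ig i : m.-integrable setT (EFin \o (fun x => g i x * g i x)) by exact: L2_ip.
have iS : m.-integrable setT (EFin \o (fun x => \sum_(i < 3) g i x * g i x)).
  rewrite (_ : EFin \o _ = (fun x => \sum_(i < 3) (g i x * g i x)%:E)%E).
    by apply: integrable_sum => // i _; exact: ig.
  by apply/funext => x /=; rewrite sumEFin.
rewrite (@ae_eq_Rintegral_nonmeasurable _ _ _ m _ (fun x => \sum_(i < 3) g i x * g i x)); last 2 first.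
- by apply/measurable_EFinP; exact: (measurable_int m iS).
- have : {ae m, forall x, forall i : 'I_3, grad w i x = g i x}.
    apply: filter_forall => i; apply: filterS (grad_ae i dg) => x; exact.
  by apply: filterS => x h _; apply: eq_bigr => i _; rewrite h.
have S0 x : 0 <= \sum_(i < 3) g i x * g i x.
  by apply: sumr_ge0 => i _; rewrite -expr2 sqr_ge0.
move=> /(ge0_Rintegral_eq0 S0 iS) gz.
have gz' (i : 'I_3) : g i = cst 0 %[ae leb3].
  apply: ae_psi_leb3; apply: filterS gz => x /(_ I) /eqP.
  rewrite psumr_eq0 => [/allP/(_ i)|j _]; last by rewrite -expr2 sqr_ge0.
  by rewrite mem_index_enum => /(_ isT); rewrite /= mulf_eq0 orbb => /eqP -> _.
have [luw dgw] := dg.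
have [c wc] : exists c, w = cst c %[ae leb3].
  apply: null_gradient_ae_cst => // i phi tphi.
  have [_ ->//] := dgw i.
  rewrite (@ae_eq_Rintegral_nonmeasurable _ _ _ leb3 _ (cst 0))//.
    by rewrite Rintegral_cst// mul0r oppr0.
  by apply: filterS (gz' i) => x + _ => /(_ I) ->; rewrite mul0r.
by exists c; exact: ae_leb3_psi.
Qed.

End form.

(** * Processes associated with a conservative semigroup *)

Section process.
Context {R : realType} {d : measure_display} {W : measurableType d}.
Variables (P : R3 R -> probability W R) (X : R -> W -> R3 R)
  (zeta : W -> \bar R).
Variable m : {measure set (R3 R) -> \bar R}.
Hypothesis m1 : m setT = 1%E.
Variable T : R -> (R3 R -> R) -> (R3 R -> R).
Hypothesis msgT : markovian_semigroup m T.
Hypothesis T_1 : conservative m T.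
Hypothesis diffX : diffusion P X zeta.
Hypothesis assocX : associated P X zeta m T.

Lemma bounded_measurable_L2 f : bounded_measurable f -> f \in Lfun m 2%:E.
Proof. by move=> [mf bf]; exact: L2_bounded. Qed.

Lemma transition_conservative : conservative m (transition P X zeta).
Proof.
move=> t t0; have bm1 : bounded_measurable (cst 1 : R3 R -> R).
  by split => //; exists 1 => x; rewrite /= normr1.
apply: ae_eq_trans (T_1 t0); exact: assocX t0 bm1 (bounded_measurable_L2 bm1).
Qed.

(** Under P x the process starts at x, and is alive, almost surely; f (X 0 w)
    is only known to equal f x outside a null set, whence an integral that does
    not presuppose measurability. *)
Lemma transition0 f x : transition P X zeta 0 f x = f x.
Proof.
have [Fil [[_ Film _ _] Filat _ X0 _]] := diffX.
have mx := measurable_set1_R3 x.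
have mE B : measurable B -> measurable (in_at X zeta 0 B).
  by move=> mB; apply: (Film 0) => //; exact: Filat.
have mD : measurable [set w | (0%:E < zeta w)%E].
  have := mE _ measurableT; rewrite /in_at; congr measurable.
  by apply/seteqP; split=> w //= [].
have PE : P x (~` in_at X zeta 0 [set x]) = 0%E.
  rewrite probability_setC; last exact: mE.
  by rewrite X0 subee.
have aeE : {ae P x, forall w, (0%:E < zeta w)%E /\ X 0 w = x}.
  by exists (~` in_at X zeta 0 [set x]); split => //; apply: measurableC; exact: mE.
rewrite /transition Rintegral_mkcond.
rewrite (@ae_eq_Rintegral_nonmeasurable _ _ _ _ _ (cst (f x)))//.
  by rewrite Rintegral_cst// (_ : _ setT = 1%E) ?mulr1//; exact: probability_setT.
by apply: filterS aeE => w [z0 Xw] _; rewrite patchE ifT ?Xw// inE.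
Qed.

Lemma transition_invariant : invariant_distribution m (transition P X zeta).
Proof.
split=> // t f; rewrite le_eqVlt => /predU1P[<-|t0] bf.
  by apply: eq_Rintegral => x _; rewrite transition0.
have lf := bounded_measurable_L2 bf.
rewrite (ae_eq_Rintegral_nonmeasurable _ (assocX t0 bf lf)).
  by rewrite -!ip_cst1 (T_ip1 m1 msgT T_1 t0 lf).
exact: L2_measurable (msg_L2 msgT t0 lf).
Qed.

End process.

Theorem proposition2p4 (R : realType) (gamma : R) (gamma_gt0 : 0 < gamma)
    (T : R -> (R3 R -> R) -> (R3 R -> R))
    (T_of_form : semigroup_of_form (psi_measure gamma)
      (form_domain gamma) (energy gamma) T) :
  [/\ recurrent (psi_measure gamma) T,
      conservative (psi_measure gamma) T &
      irreducible (psi_measure gamma) T] /\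
  forall (d : measure_display) (W : measurableType d)
    (P : R3 R -> probability W R) (X : R -> W -> R3 R) (zeta : W -> \bar R),
    diffusion P X zeta ->
    associated P X zeta (psi_measure gamma) T ->
    conservative (psi_measure gamma) (transition P X zeta) /\
    invariant_distribution (psi_measure gamma) (transition P X zeta).
Proof.
have m1 := psi_measure_setT gamma_gt0.
have msgT := T_of_form.1.
have T_1 := form_conservative gamma_gt0 T_of_form.
have fix_cst := form_fixed_cst gamma_gt0 T_of_form.
split.
  split => //.
  - exact: (ergodic_recurrent m1 msgT T_1 fix_cst).
  - exact: (fixed_cst_irreducible m1 T_1 fix_cst).
move=> d W P X zeta diffX assocX; split.
  exact: (transition_conservative m1 T_1 assocX).
exact: (transition_invariant m1 msgT T_1 diffX assocX).
Qed.
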